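(* Let $d\in\mathbb{N}$, let $f:\mathbb{R}^n\to\mathbb{R}$ be a function that is bounded on $\mathcal{B}(\mathbf{0},2d\sqrt{n})$, and for $\varepsilon\in(0,1)$ and $R>0$ let $\mathcal{D}$ be an $(\varepsilon/4,R)$-concentrated distribution on $\mathbb{R}^n$. Given $\alpha>0$ and $\beta\geq 2^{(2n)^{O(d)}}R^d\alpha$, query access to $f$, and sampling access to $\mathcal{D}$, there is a one-sided error tester making $O\!\left(d^5+\frac{d^2}{\varepsilon}\log\frac{1}{\varepsilon}\right)$ queries which distinguishes (with probability at least $2/3$) between the case when $f$ is pointwise $\alpha$-close to some polynomial of degree at most $d$, and the case when for every polynomial $h:\mathbb{R}^n\to\mathbb{R}$ of degree at most $d$, $\Pr_{\mathbf{p}\sim\mathcal{D}}[|f(\mathbf{p})-h(\mathbf{p})|>\beta]>\varepsilon$.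
   Context: $\mathcal{B}(\mathbf{c},r)$ denotes the open Euclidean ball of radius $r$ centered at $\mathbf{c}$. A distribution $\mathcal{D}$ on $\mathbb{R}^n$ is $(\varepsilon,R)$-concentrated if $\Pr_{\mathbf{p}\sim\mathcal{D}}[\mathbf{p}\in\mathcal{B}(\mathbf{0},R)]\geq 1-\varepsilon$. $f$ is pointwise $\alpha$-close to $h$ if $|f(\mathbf{x})-h(\mathbf{x})|<\alpha$ for all $\mathbf{x}\in\mathbb{R}^n$. The tester has query access to $f$ and sample access to the unknown $\mathcal{D}$ (and its own randomness); one-sided error means it accepts with probability $1$ in the first (close) case, and it rejects with probability at least $2/3$ in the second case. Query complexity counts queries to $f$.
   Formalization: The bound on β uses max(1,R)^d instead of R^d, since for very small R a function can be both α-close and β-far; d is at least 1 (d = 0 would allow no queries); in the second case f is assumed Borel measurable so that the probabilities are defined. *)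

(* Defs.v *)
From HB Require Import structures.
From mathcomp Require Import all_boot all_order all_algebra.
From mathcomp Require Import all_classical all_reals all_analysis.
(* The notations of [mpoly] clash with those of the analysis library. *)
From mathcomp Require Import -(notations) mpoly.

Set Implicit Arguments.
Unset Strict Implicit.
Unset Printing Implicit Defensive.

Import Order.TTheory GRing.Theory Num.Theory.
Import numFieldNormedType.Exports.

Local Open Scope classical_set_scope.
Local Open Scope ring_scope.

(* R^n; the sigma-algebra that the library puts on tuples is the product of the
   Borel sigma-algebras, that is, the Borel sigma-algebra of R^n. *)
Notation Rn R n := (n.-tuple (measurableTypeR R)).

Section Euclidean.
Variables (R : realType) (n : nat).

(* Spelled out because the library norm on R^n is the sup norm. *)
Definition edist (x y : Rn R n) : R :=
  Num.sqrt (\sum_(i < n) (tnth x i - tnth y i : R) ^+ 2).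

Definition eball (c : Rn R n) (r : R) : set (Rn R n) :=
  [set x | edist c x < r].

Definition origin : Rn R n := [tuple (0 : R) | i < n].

(* [msize p] is one more than the total degree of p, and 0 for p = 0. *)
Definition poly_degree_le (d : nat) (h : Rn R n -> R) : Prop :=
  exists p : mpoly n R, (mpoly.msize p <= d.+1)%N /\
    forall x, h x = meval (fun i => tnth x i : R) p.

Definition pointwise_close (alpha : R) (f h : Rn R n -> R) : Prop :=
  forall x, `|f x - h x| < alpha.

Definition concentrated (eps r : R) (D : probability (Rn R n) R) : Prop :=
  ((1 - eps)%:E <= D (eball origin r))%E.

End Euclidean.

Arguments origin {R n}.

Section IID.
Context {disp : measure_display} {T : measurableType disp} {R : realType}.

Definition cons_point m (p : T * m.-tuple T) : m.+1.-tuple T :=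
  [tuple of p.1 :: p.2].

Lemma measurable_cons_point m : measurable_fun setT (@cons_point m).
Proof.
apply: measurable_cons; [exact: measurable_fst | exact: measurable_snd].
Qed.

HB.instance Definition _ m :=
  @isMeasurableFun.Build _ _ _ _ (@cons_point m) (@measurable_cons_point m).

(* The law D^m of m independent samples of D. *)
Fixpoint iid (D : probability T R) (m : nat) : probability (m.-tuple T) R :=
  match m with
  | 0 => \d_([tuple] : 0.-tuple T)
  | m'.+1 => distribution (D \x iid D m')%E (@cons_point m')
  end.

Lemma iid_rect (D : probability T R) m (A : 'I_m -> set T) :
  (forall i, measurable (A i)) ->
  iid D m [set s | forall i, A i (tnth s i)] = (\prod_(i < m) D (A i))%E.
Proof.
elim: m A => [|m IH] A mA.
  by rewrite big_ord0 /= /dirac /= indicE mem_set //=; case.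
rewrite big_ord_recl /= -IH; last by move=> i; exact: mA.
rewrite /distribution /pushforward -product_measure1E //=.
  congr (_ _); apply/seteqP; split => -[x s] /= h.
    split; first exact: (h ord0).
    move=> i; have := h (lift ord0 i); rewrite tnthS.
    by congr (A _ (tnth _ _)); apply/val_inj.
  move=> i; case: (unliftP ord0 i) => [j|] ->; last exact: h.1.
  by rewrite tnthS; have := h.2 j; congr (A _ (tnth _ _)); apply/val_inj.
have -> : [set s : m.-tuple T | forall i, A (lift ord0 i) (tnth s i)] =
    \bigcap_(i in setT)
      ((fun s : m.-tuple T => tnth s i) @^-1` A (lift ord0 i)).
  by apply/seteqP; split => s /= h i; [move=> _|]; apply: h.
apply: fin_bigcap_measurable => // i _.
rewrite -[X in measurable X]setTI; exact: (measurable_tnth i).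
Qed.

End IID.

(* A deterministic adaptive algorithm with query access to a function X -> Y. *)
Inductive query_tree (X Y : Type) : Type :=
| Output of bool
| Query of X & (Y -> query_tree X Y).

Section Run.
Variables (X Y : Type) (f : X -> Y).

Fixpoint run (t : query_tree X Y) : bool :=
  match t with
  | Output b => b
  | Query x next => run (next (f x))
  end.

Fixpoint num_queries (t : query_tree X Y) : nat :=
  match t with
  | Output _ => 0
  | Query x next => (num_queries (next (f x))).+1
  end.

End Run.

(* A tester draws its private randomness and finitely many samples of the
   unknown distribution, and then queries f adaptively.  It sees f only through
   the query tree and the distribution only through the samples. *)
Record tester (R : realType) (n : nat) : Type := Tester {
  seed_display : measure_display;
  seed : measurableType seed_display;
  seed_law : probability seed R;
  num_samples : nat;
  strategy : seed -> num_samples.-tuple (Rn R n) ->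
             query_tree (Rn R n) R
}.

Section Outcome.
Variables (R : realType) (n : nat) (T : tester R n).

Definition run_law (D : probability (Rn R n) R) :
    probability (seed T * (num_samples T).-tuple (Rn R n))%type R :=
  (seed_law T \x iid D (num_samples T))%E.

(* [b = true] means that T accepts f. *)
Definition outcome_event (f : Rn R n -> R) (b : bool) :
    set (seed T * (num_samples T).-tuple (Rn R n))%type :=
  [set w | run f (strategy w.1 w.2) = b].

End Outcome.

Arguments outcome_event {R n} T f b.

(* Inner probability, which is P A for measurable A; it makes sense for the
   outcome events of a tester run on an arbitrary function. *)
Definition has_prob_ge disp (T : measurableType disp) (R : realType)
    (P : probability T R) (A : set T) (p : R) : Prop :=
  exists E : set T, [/\ measurable E, E `<=` A & (p%:E <= P E)%E].

(* Main.v *)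
(* After rescaling, the ball of radius r is tiny compared with the unit cube, and the
   uniform law of the cube is almost invariant under translations by small vectors
   and dilations of ratio close to 1.  The tester checks that f agrees with its
   degree-d interpolation on random lines x + t q, where the nodes are t close to 1
   and the tested parameter is t = 0 or a random real t.  If these tests pass with
   high probability, then extrapolating f from the far end of a random line through
   y gives, for most lines, nearly the same value g(y), for every y near the origin;
   moreover g is nearly a polynomial of degree d on every line near the origin.
   Interpolating coordinate by coordinate and dropping the terms of degree above d
   yields a polynomial h of degree d close to g, with an error factor exponential
   in a power of nd.  A sample p with f(p) far from h(p), hence far from g(p), is
   detected by extrapolating f to p along one random line. *)
Require Import Defs.
From HB Require Import structures.
From mathcomp Require Import all_boot all_order all_algebra.
From mathcomp Require Import all_classical all_reals all_analysis.
From mathcomp Require Import -(notations) mpoly.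
From mathcomp Require Import measurable_realfun.
From mathcomp Require Import zify ring lra.
Import Order.TTheory GRing.Theory Num.Theory.
Import numFieldNormedType.Exports.
Local Open Scope classical_set_scope.
Local Open Scope ring_scope.

Set Implicit Arguments.
Unset Strict Implicit.
Unset Printing Implicit Defensive.

(** * Product measures *)

Section Probability.
Context {R : realType}.

(** The spacing of the nodes is squeezed from both sides. Almost invariance wants all of them within
    about [1 / (n * d ^ 2)] of 1, whereas extrapolating to 0 from nodes that close together can
    multiply an error by [weight_bound], which grows like [(4 / step) ^ d]. Every interpolation pays
    this factor, and this is where the exponential loss comes from. Directions are used at two
    scales. For [y] near the origin, [y + t q] is distributed almost like [q] only when [t] is near
    1. If instead [q] is first shrunk by [small_dir], then [x + t q] is distributed almost like [x]
    for every [t] in [[-2, 2]], so that values of [g] can be compared at parameters far from the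
    nodes. The threshold [tau] bounds the residual of a function close to a polynomial on every
    line, not just on most of them. Completeness is therefore deterministic, and probability enters
    only in the far case. *)

Lemma union_bound d (T : measurableType d) (P : probability T R)
    (I : finType) (B : I -> set T) :
  (forall i, measurable (B i)) ->
  measurable [set x | exists i, B i x] /\
  (P [set x | exists i, B i x] <= \sum_(i : I) P (B i))%E.
Proof.
move=> mB.
have -> : [set x | exists i, B i x] = \big[setU/set0]_(i <- index_enum I) B i.
  rewrite -bigcup_seq; apply/seteqP; split=> x.
    by move=> [i Bi]; exists i => //=; rewrite mem_index_enum.
  by move=> [i _ Bi]; exists i.
elim: (index_enum I) => [|i s [ms IH]].
  by rewrite !big_nil measure0; split => //; exact: measurable0.
rewrite !big_cons; split; first exact: measurableU.
apply: (le_trans (measureU2 _ _ _)) => //.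
by rewrite leeD2l.
Qed.

Lemma union_bound_cst d (T : measurableType d) (P : probability T R)
    (I : finType) (B : I -> set T) (b : R) :
  (forall i, measurable (B i)) -> (forall i, (P (B i) <= b%:E)%E) ->
  measurable [set x | exists i, B i x] /\
  (P [set x | exists i, B i x] <= (#|I|%:R * b)%:E)%E.
Proof.
move=> mB hB; have [mU hU] := union_bound P mB; split => //.
apply: (le_trans hU); apply: (@le_trans _ _ (\sum_(i : I) b%:E)%E).
  by apply: lee_sum => i _; exact: hB.
by rewrite sumEFin sumr_const mulr_natl.
Qed.

Lemma exists_notin d (T : measurableType d) (P : probability T R) (A : set T) :
  (P A < 1)%E -> exists x, ~ A x.
Proof.
move=> A1; apply/existsNP => h; move: A1.
have -> : A = setT by apply/seteqP; split.
by rewrite probability_setT ltxx.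
Qed.

Lemma integral_probability_cst d (T : measurableType d)
    (P : probability T R) (b : R) : (\int[P]_x b%:E)%E = b%:E.
Proof.
by rewrite integral_cst; [rewrite [X in (_ * X)%E]probability_setT mule1|
  exact: measurableT].
Qed.

Section Product.
Context d1 d2 (T1 : measurableType d1) (T2 : measurableType d2).
Variables (P : probability T1 R) (Q : probability T2 R).
Implicit Type A : set (T1 * T2).

Lemma product_probability_xsection A : measurable A ->
  (P \x Q)%E A = (\int[P]_x Q (xsection A x))%E.
Proof. by []. Qed.

Lemma product_probability_ysection A : measurable A ->
  (P \x Q)%E A = (\int[Q]_y P (ysection A y))%E.
Proof.
move=> mA; have := indic_fubini_tonelli P Q mA.
rewrite (_ : fubini_F _ _ = Q \o xsection A); last exact: indic_fubini_tonelli_FE.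
by rewrite (_ : fubini_G _ _ = P \o ysection A); last exact: indic_fubini_tonelli_GE.
Qed.

(** Fubini reduces the claim to the sections. The null set outside [G] is allowed because a shift by
    a short random direction is under control only when that direction lies in the cube, which is
    merely almost sure. *)
Lemma prod_perturb_l (f : T2 -> T1 -> T1) A (G : set T2) (k : R) :
  measurable A -> measurable_fun setT (fun w : T1 * T2 => f w.2 w.1) ->
  0 <= k -> measurable G -> Q (~` G) = 0%E ->
  (forall y B, G y -> measurable B -> (P (f y @^-1` B) <= P B + k%:E)%E) ->
  ((P \x Q) [set w | A (f w.2 w.1, w.2)] <= (P \x Q) A + k%:E)%E.
Proof.
move=> mA mf k0 mG G0 hf.
have mg : measurable_fun setT (fun w : T1 * T2 => (f w.2 w.1, w.2)).
  by exact/measurable_fun_pair.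
have mA' : measurable [set w : T1 * T2 | A (f w.2 w.1, w.2)].
  by rewrite -[X in measurable X]setTI; exact: mg.
rewrite !product_probability_ysection //.
rewrite -(integral_probability_cst Q k).
rewrite -ge0_integralD //; last first.
  exact: (measurable_fun_ysection P mA).
apply: ae_ge0_le_integral => //.
- exact: (measurable_fun_ysection P mA').
- by move=> y _; rewrite adde_ge0.
- by apply: emeasurable_funD => //; exact: (measurable_fun_ysection P mA).
exists (~` G); split => //; first exact: measurableC.
move=> y /= hy Gy; apply: hy => _.
have -> : ysection [set w | A (f w.2 w.1, w.2)] y = f y @^-1` (ysection A y).
  by apply/seteqP; split=> x; rewrite /ysection /= !inE.
by apply: hf => //; exact: measurable_ysection.
Qed.

Lemma prod_perturb_r (f : T1 -> T2 -> T2) A (k : R) :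
  measurable A -> measurable_fun setT (fun w : T1 * T2 => f w.1 w.2) ->
  0 <= k ->
  (forall x B, measurable B -> (Q (f x @^-1` B) <= Q B + k%:E)%E) ->
  ((P \x Q) [set w | A (w.1, f w.1 w.2)] <= (P \x Q) A + k%:E)%E.
Proof.
move=> mA mf k0 hf.
have mg : measurable_fun setT (fun w : T1 * T2 => (w.1, f w.1 w.2)).
  by exact/measurable_fun_pair.
have mA' : measurable [set w : T1 * T2 | A (w.1, f w.1 w.2)].
  by rewrite -[X in measurable X]setTI; exact: mg.
rewrite !product_probability_xsection //.
rewrite -(integral_probability_cst P k).
rewrite -ge0_integralD //; last first.
  exact: (measurable_fun_xsection Q mA).
apply: ge0_le_integral => //.
- exact: (measurable_fun_xsection Q mA').
- by apply: emeasurable_funD => //; exact: (measurable_fun_xsection Q mA).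
move=> x _ /=.
have -> : xsection [set w | A (w.1, f w.1 w.2)] x = f x @^-1` (xsection A x).
  by apply/seteqP; split=> y; rewrite /xsection /= !inE.
by apply: hf; exact: measurable_xsection.
Qed.

(** Averaging: sections all larger than [b] would integrate to at least [b > a]. This is how a
    random direction gets fixed. *)
Lemma exists_ysection_le A (a b : R) : measurable A ->
  ((P \x Q) A <= a%:E)%E -> a < b -> exists y, (P (ysection A y) <= b%:E)%E.
Proof.
move=> mA hA ab; apply/not_existsP => h.
have b0 : 0 <= b.
  rewrite -lee_fin (le_trans (measure_ge0 (P \x Q)%E A)) // (le_trans hA) //.
  by rewrite lee_fin ltW.
move: hA; rewrite product_probability_ysection // leNgt => /negP; apply.
apply: (@lt_le_trans _ _ b%:E); first by rewrite lte_fin.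
rewrite -(integral_probability_cst Q b).
apply: ge0_le_integral => //.
  exact: (measurable_fun_ysection P mA).
by move=> y _; apply: ltW; rewrite ltNge; apply/negP; exact: h.
Qed.

Lemma prod_ge_of_ysection A (G : set T2) (c : R) : measurable A ->
  measurable G -> 0 <= c -> (forall y, G y -> (c%:E <= P (ysection A y))%E) ->
  (c%:E * Q G <= (P \x Q) A)%E.
Proof.
move=> mA mG c0 h; rewrite product_probability_ysection //.
rewrite -(setIT G) -integral_cst //; last by rewrite setIT.
apply: (@le_trans _ _ (\int[Q]_(y in G) P (ysection A y))%E).
  rewrite setIT; apply: ge0_le_integral => //.
  apply: (measurable_funS measurableT) => //.
  exact: (measurable_fun_ysection P mA).
apply: ge0_subset_integral => //.
exact: (measurable_fun_ysection P mA).
Qed.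

End Product.

Lemma prod_swap d1 d2 (T1 : measurableType d1) (T2 : measurableType d2)
    (P : probability T1 R) (Q : probability T2 R) (A : set (T1 * T2)) :
  measurable A ->
  (Q \x P)%E [set w | A (w.2, w.1)] = (P \x Q)%E A.
Proof.
move=> mA.
have mg : measurable_fun setT (fun w : T2 * T1 => (w.2, w.1)).
  by exact/measurable_fun_pair.
have mA' : measurable [set w : T2 * T1 | A (w.2, w.1)].
  by rewrite -[X in measurable X]setTI; exact: mg.
exact: product_probability_ysection.
Qed.


End Probability.

(** * Almost invariance of the uniform law on the cube *)

Section Uniform.
Context {R : realType}.
Local Notation mu := (@lebesgue_measure R).
Implicit Types (s c b theta Y : R) (B : set (measurableTypeR R)).

Definition unif01 : probability (measurableTypeR R) R :=
  uniform_prob (@ltr01 R).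

Lemma unif01E B : measurable B -> unif01 B = mu (B `&` `[0, 1]%classic).
Proof.
move=> mB; rewrite /unif01 /= /uniform_prob integral_uniform_pdf.
rewrite (eq_integral (cst 1%E)).
  by rewrite integral_cst ?mul1e //; exact: measurableI.
move=> x; rewrite inE /= => -[_]; rewrite in_itv /= /uniform_pdf => ->.
by rewrite subr0 invr1.
Qed.

Lemma measurable_affine s c :
  measurable_fun setT (fun x : measurableTypeR R => s * x + c : measurableTypeR R).
Proof.
by apply: measurable_funD => //; apply: measurable_funM.
Qed.

Lemma lebesgue_affine s c B : 0 < s -> measurable B ->
  mu B = (s%:E * mu ((fun x => s * x + c)%R @^-1` B))%E.
Proof.
move=> s0 mB.
pose f : measurableTypeR R -> measurableTypeR R := fun x => s * x + c.
have mf : measurable_fun setT f := measurable_affine s c.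
pose m : {measure set (measurableTypeR R) -> \bar R} :=
  mscale (NngNum (ltW s0)) (pushforward mu f).
rewrite (@lebesgue_measure_unique R (m mf)) //.
move=> X [[a b] /= ab <-].
rewrite /m /= /mscale /= /pushforward /=.
have -> : f @^-1` `]a, b] = `](a - c) / s, (b - c) / s]%classic.
  apply/seteqP; split=> x /=; rewrite /f !in_itv /=;
  by rewrite ltr_pdivrMr // ler_pdivlMr // ltrBlDr lerBrDr (mulrC x).
rewrite !lebesgue_measure_itv /= !lte_fin.
rewrite ltr_pM2r ?invr_gt0 // ltrD2r; case: ifPn => // _; last by rewrite mule0.
rewrite -!EFinD -EFinM; congr (_%:E).
by field; rewrite gt_eqF.
Qed.

(** The image of the uniform law has density [1 / s] on the part that stays in the unit interval;
    the last term is the mass that leaves it. *)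
Lemma unif01_affine s c B : 0 < s -> measurable B ->
  (unif01 ((fun x => s * x + c)%R @^-1` B) <=
   (s^-1)%:E * unif01 B +
   mu (`[0%R, 1%R] `\` (fun x => s * x + c)%R @^-1` `[0%R, 1%R]))%E.
Proof.
move=> s0 mB.
have mf := measurable_affine s c.
set f := (fun x => _).
have mpre A : measurable A -> measurable (f @^-1` A).
  by move=> mA; rewrite -[X in measurable X]setTI; exact: mf.
rewrite !unif01E //; last exact: mpre.
have -> : (s^-1%:E * mu (B `&` `[0%R, 1%R]) =
    mu (f @^-1` (B `&` `[0%R, 1%R])))%E.
  rewrite (@lebesgue_affine s c (B `&` `[0%R, 1%R]%classic)) //; last exact: measurableI.
  by rewrite muleA -EFinM mulVf ?mul1e // gt_eqF.
apply: le_trans (measureU2 _ _ _); last 2 first.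
- by apply: mpre; exact: measurableI.
- by apply: measurableD => //; exact: mpre.
apply: le_measure; rewrite ?inE.
- by apply: measurableI => //; exact: mpre.
- by apply: measurableU; [apply: mpre; exact: measurableI|
    apply: measurableD => //; exact: mpre].
move=> x [Bx x01].
by case: (pselect ((f @^-1` `[0%R, 1%R]) x)) => h; [left; split|right; split].
Qed.

Lemma unif01_near_id s c theta Y B : 1 <= s -> s <= 1 + theta ->
  `|c| <= Y -> measurable B ->
  (unif01 ((fun x => s * x + c)%R @^-1` B) <= unif01 B + (2 * Y + theta)%:E)%E.
Proof.
move=> s1 st cY mB.
have s0 : 0 < s by lra.
have mf := measurable_affine s c.
have mpre A : measurable A -> measurable ((fun x => s * x + c)%R @^-1` A).
  by move=> mA; rewrite -[X in measurable X]setTI; exact: mf.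
apply: (le_trans (unif01_affine c s0 mB)); apply: leeD.
  by rewrite -[leRHS]mul1e lee_wpmul2r // lee_fin invf_le1.
have [c1 c2] : - Y <= c /\ c <= Y by move: cY; rewrite ler_norml => /andP[].
(* A point of the unit interval can leave it only from within [Y] of 0 or within [Y + theta] of 1,
   because [s * x] lies between [x] and [x + theta]. *)
apply: (@le_trans _ _ (mu (`[0%R, Y] `|` `[(1 - Y - theta)%R, 1%R]))%E).
  apply: le_measure; rewrite ?inE.
  - by apply: measurableD => //; exact: mpre.
  - exact: measurableU.
  move=> x []; rewrite /= !in_itv /= => /andP[x0 x1] /negP.
  rewrite negb_and -!ltNge => /orP[h|h]; [left|right].
    by apply/andP; split => //; nra.
  by apply/andP; split => //; nra.
apply: (le_trans (measureU2 _ _ _)) => //.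
rewrite [leLHS]/= !lebesgue_measure_itv /= !lte_fin.
by case: ifPn => _; case: ifPn => _; rewrite -?EFinB -?EFinD ?adde0 ?add0e lee_fin; lra.
Qed.

End Uniform.

Section Cube.
Context {R : realType}.

Definition line n (x q : Rn R n) (t : R) : Rn R n :=
  [tuple (tnth x i + t * tnth q i : R) | i < n].

Lemma tnth_line n (x q : Rn R n) t i :
  tnth (line x q t) i = tnth x i + t * tnth q i.
Proof. by rewrite tnth_mktuple. Qed.

Lemma line0 n (x q : Rn R n) : line x q 0 = x.
Proof. by apply: eq_from_tnth => i; rewrite tnth_line mul0r addr0. Qed.

Lemma measurable_line d (T : measurableType d) n (t : T -> measurableTypeR R)
    (f g : T -> Rn R n) :
  measurable_fun setT f -> measurable_fun setT g -> measurable_fun setT t ->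
  measurable_fun setT (fun w => line (f w) (g w) (t w)).
Proof.
move=> mf mg mt; apply/measurable_fun_tnthP => i.
rewrite (_ : _ \o _ = fun w => tnth (f w) i + t w * tnth (g w) i);
  last by apply/funext => w /=; rewrite tnth_line.
apply: measurable_funD.
  exact: (measurableT_comp (measurable_tnth i) mf).
apply: measurable_funM => //.
exact: (measurableT_comp (measurable_tnth i) mg).
Qed.

Definition cube n : probability (Rn R n) R := iid unif01 n.

(* The coordinates are replaced one at a time, by Fubini. *)
Lemma cube_near_id n (s theta Y : R) (y : Rn R n) B : 1 <= s -> s <= 1 + theta ->
  (forall i, `|tnth y i| <= Y) -> 0 <= Y -> measurable B ->
  (cube n ((fun x => line y x s) @^-1` B) <=
     cube n B + (n%:R * (2 * Y + theta))%:E)%E.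
Proof.
move=> s1 st hy Y0 mB.
have k0 : 0 <= 2 * Y + theta by lra.
elim: n y hy B mB => [|n IH] y hy B mB.
  rewrite mul0r adde0.
  suff -> : (fun x => line y x s) @^-1` B = B by [].
  by apply/seteqP; split=> x /=; rewrite (tuple0 (line _ _ _)) (tuple0 x).
have mcons := @measurable_cons_point _ (measurableTypeR R) n.
pose A := (@cons_point _ (measurableTypeR R) n) @^-1` B.
have mA : measurable A.
  by rewrite -[X in measurable X]setTI; exact: mcons.
pose y' : Rn R n := [tuple (tnth y (lift ord0 i) : R) | i < n].
have my (c : R) (z : Rn R n) : measurable_fun setT
    (fun w : measurableTypeR R * Rn R n => line z w.2 c).
  by apply: measurable_line.
pose A' := [set w | A (w.1, line y' w.2 s)].
have mA' : measurable A'.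
  rewrite -[X in measurable X]setTI.
  by apply: (measurable_fun_pair _ (my s y')) => //.
rewrite /= /distribution /pushforward.
have -> : cons_point (m:=n) @^-1` ((fun x => line y x s) @^-1` B) =
    [set w | A' (s * w.1 + tnth y ord0, w.2)].
  apply/seteqP; split=> -[x0 x] /=; rewrite /A' /A /=;
  congr (B _); apply: eq_from_tnth => i; rewrite tnth_line;
  case: (unliftP ord0 i) => [j|] ->; rewrite /cons_point /=;
  by rewrite ?tnth0 ?tnthS ?tnth_line ?tnth_mktuple // addrC.
pose f (_ : Rn R n) (x : measurableTypeR R) : measurableTypeR R :=
  s * x + tnth y ord0.
have mf : measurable_fun setT (fun w : measurableTypeR R * Rn R n => f w.2 w.1).
  by apply: measurable_funD => //; apply: measurable_funM.
have E1 := @prod_perturb_l R _ _ _ _ unif01 (cube n) f A' setT _ mA' mf k0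
  measurableT _ (fun _ C _ mC => unif01_near_id s1 st (hy ord0) mC).
apply: (le_trans (E1 _)); first by rewrite setCT measure0.
have -> : ((n.+1%:R * (2 * Y + theta))%:E =
    (n%:R * (2 * Y + theta))%:E + (2 * Y + theta)%:E)%E.
  by rewrite -EFinD -natr1 mulrDl mul1r.
rewrite addeA; apply: leeD => //.
apply: (@prod_perturb_r R _ _ _ _ unif01 (cube n) (fun _ x => line y' x s) A
  _ mA (my s y')).
  by rewrite mulr_ge0.
by move=> _ C mC; apply: IH => // i; rewrite tnth_mktuple.
Qed.

Lemma measurable_tnth_forall d (T : measurableType d) k (A : 'I_k -> set T) :
  (forall i, measurable (A i)) ->
  measurable [set s : k.-tuple T | forall i, A i (tnth s i)].
Proof.
move=> mA; have -> : [set s : k.-tuple T | forall i, A i (tnth s i)] =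
    \bigcap_(i in setT) ((fun s : k.-tuple T => tnth s i) @^-1` A i).
  by apply/seteqP; split => s h i; [move=> _|]; apply: h.
apply: fin_bigcap_measurable => // i _.
rewrite -[X in measurable X]setTI.
exact: (measurable_tnth i measurableT (mA i)).
Qed.

Lemma cube_support n :
  measurable [set u : Rn R n | forall i, 0 <= tnth u i <= 1] /\
  cube n (~` [set u : Rn R n | forall i, 0 <= tnth u i <= 1]) = 0%E.
Proof.
have e : [set u : Rn R n | forall i, 0 <= tnth u i <= 1] =
    [set u | forall i : 'I_n, (`[0, 1]%classic : set (measurableTypeR R)) (tnth u i)].
  by apply/seteqP; split=> u h i; have := h i; rewrite /= in_itv.
have mG : measurable [set u : Rn R n | forall i, 0 <= tnth u i <= 1].
  rewrite e; exact: (@measurable_tnth_forall _ (measurableTypeR R) n (fun=> `[0, 1]%classic)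
    (fun=> measurable_itv _)).
split => //; rewrite probability_setC // e.
have h := @iid_rect _ _ _ unif01 n (fun=> `[0, 1]%classic)
  (fun=> measurable_itv _).
rewrite /cube h big1 ?subee // => i _.
by rewrite unif01E // setIid lebesgue_measure_itv /= lte_fin ltr01 sube0.
Qed.

End Cube.

(** * Interpolation on a line *)

Section Interpolation.
Context {R : realType}.
Variables (d : nat) (dl : R).

(* All nodes are close to 1, so that [x + node i * q] is nearly distributed as [q]
   when [x] is small; interpolating at 0 from them is an extrapolation. *)
Definition node (i : nat) : R := 1 + i%:R * dl.

Definition lag (i : 'I_d.+1) : {poly R} := tnth (lagrange d.+1 node) i.

Definition weight (t : R) (i : 'I_d.+1) : R := (lag i).[t].

Definition weight_bound : R := d.+1%:R * (4 / dl) ^+ d.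

Hypothesis dl0 : 0 < dl.

Lemma node_inj : injective node.
Proof.
move=> i j; rewrite /node => /addrI /(mulIf (lt0r_neq0 dl0)) /eqP.
by rewrite eqr_nat => /eqP.
Qed.

Lemma weight_poly (t : R) (p : {poly R}) : (size p <= d.+1)%N ->
  \sum_(i < d.+1) weight t i * p.[node i] = p.[t].
Proof.
move=> sp; rewrite [in RHS](lagrange_gen (ltn0Sn d) node_inj sp) horner_sum.
by apply: eq_bigr => i _; rewrite hornerM hornerC mulrC.
Qed.

Lemma size_lag i : (size (lag i) <= d.+1)%N.
Proof. by rewrite /lag size_lagrange_ //; exact: node_inj. Qed.

(** As a function of [s], [weight (t + s * r) i] is a polynomial of degree at most [d], so its
    extrapolation from the nodes to 0 is exact. This merges two nested interpolations into one. *)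
Lemma weight_affine (t r : R) i :
  \sum_(k < d.+1) weight 0 k * weight (t + node k * r) i = weight t i.
Proof.
pose p := comp_poly (t%:P + r *: 'X)%R (lag i).
have sq : (size (t%:P + r *: 'X)%R <= 2)%N.
  rewrite (leq_trans (size_polyD _ _)) // geq_max size_polyC.
  by rewrite (leq_trans (leq_b1 _)) //= (leq_trans (size_scale_leq _ _)) // size_polyX.
have sp : (size p <= d.+1)%N.
  rewrite (leq_trans (size_comp_poly_leq _ _)) //.
  have h : ((size (lag i)).-1 * (size (t%:P + r *: 'X)%R).-1 <= d * 1)%N.
    apply: leq_mul; first by have := size_lag i; case: (size (lag i)).
    by move: sq; case: (size _).
  by rewrite ltnS (leq_trans h) // muln1.
have pE s : p.[s] = weight (t + s * r) i.
  by rewrite /p /weight horner_comp !hornerE /= mulrC.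
have := weight_poly 0 sp; rewrite pE mul0r addr0 => <-.
by apply: eq_bigr => k _; rewrite pE.
Qed.

Hypothesis dl1 : d%:R * dl <= 1.

Lemma node_ge1 i : 1 <= node i.
Proof. by rewrite /node lerDl mulr_ge0 // ltW. Qed.

Lemma node_le_theta (i : 'I_d.+1) : node i <= 1 + d%:R * dl.
Proof. by rewrite /node lerD2l ler_pM2r // ler_nat -ltnS. Qed.

Lemma node_le2 (i : 'I_d.+1) : node i <= 2.
Proof. by rewrite (le_trans (node_le_theta i)) // -[2]/(1 + 1) lerD2l. Qed.

(** Each of the [d] Lagrange factors has numerator at most [2 + 2] and denominator at least the
    spacing [dl]. *)
Lemma weight_le (t : R) i : `|t| <= 2 -> `|weight t i| <= (4 / dl) ^+ d.
Proof.
move=> t2; rewrite /weight /lag (lagrangeE (ltn0Sn d) node_inj) /=.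
rewrite hornerM hornerC !horner_prod normrM normfV !normr_prod mulrC.
have cardi : #|[pred j : 'I_d.+1 | j != i]| = d.
  have := cardC1 i; rewrite card_ord => /= h; apply: etrans h.
  by apply: eq_card => j; rewrite !inE.
have prod_cst (c : R) : \prod_(j < d.+1 | j != i) c = c ^+ d.
  by rewrite prodr_const cardi.
have lo : dl ^+ d <= \prod_(j < d.+1 | j != i) `|('X - (node j)%:P).[node i]|.
  rewrite -prod_cst; apply: ler_prod => j ji.
  rewrite (ltW dl0) /= hornerXsubC /node opprD addrACA subrr add0r -mulrBl.
  rewrite normrM (gtr0_norm dl0) ler_peMl ?(ltW dl0) //.
  have ij : (i : nat) != j by rewrite eq_sym; exact: ji.
  have [lij|lij] := leqP i j.
    rewrite distrC -natrB // normr_nat ler1n subn_gt0 ltn_neqAle ij lij //.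
  by rewrite -natrB ?(ltnW lij) // normr_nat ler1n subn_gt0.
have hi : \prod_(j < d.+1 | j != i) `|('X - (node j)%:P).[t]| <= 4 ^+ d.
  rewrite -prod_cst; apply: ler_prod => j ji.
  rewrite normr_ge0 /= hornerXsubC (le_trans (ler_normB _ _)) //.
  have := node_le2 j; have := node_ge1 j => h1 h2.
  by rewrite (ger0_norm (_ : 0 <= node j)); lra.
rewrite expr_div_n ler_pM // ?prodr_ge0 // ?invr_ge0 ?prodr_ge0 //.
by rewrite lef_pV2 // posrE ?exprn_gt0 // (lt_le_trans _ lo) ?exprn_gt0.
Qed.

Hypothesis d0 : (0 < d)%N.

Lemma step_le1 : dl <= 1.
Proof. by apply: le_trans dl1; rewrite ler_peMl ?ler1n // ltW. Qed.

Lemma weight_bound_ge1 : 1 <= weight_bound.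
Proof.
rewrite /weight_bound mulr_ege1 ?ler1n // exprn_ege1 //.
by rewrite ler_pdivlMr // mul1r; have := step_le1; lra.
Qed.

Lemma weight_sum_le (t K : R) (e : 'I_d.+1 -> R) : `|t| <= 2 ->
  (forall i, `|e i| <= K) ->
  `|\sum_(i < d.+1) weight t i * e i| <= weight_bound * K.
Proof.
move=> t2 he; apply: (le_trans (ler_norm_sum _ _ _)).
apply: (@le_trans _ _ (\sum_(i < d.+1) (4 / dl) ^+ d * K)).
  by apply: ler_sum => i _; rewrite normrM ler_pM // weight_le.
by rewrite sumr_const card_ord /weight_bound -mulrA (mulr_natl _ d.+1).
Qed.

Lemma weight_sum_close (t K : R) (a b : 'I_d.+1 -> R) : `|t| <= 2 ->
  (forall i, `|a i - b i| <= K) ->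
  `|\sum_(i < d.+1) weight t i * a i - \sum_(i < d.+1) weight t i * b i|
    <= weight_bound * K.
Proof.
move=> t2 h; rewrite -sumrB.
under eq_bigr do rewrite -mulrBr.
exact: weight_sum_le.
Qed.

End Interpolation.


Section PolyLine.
Context {R : realType} {n : nat}.
Implicit Types (p : mpoly n R) (x q v : Rn R n) (t : R).

Definition peval p x : R := meval (fun i => tnth x i : R) p.

Lemma poly_on_line (d : nat) p x q : (msize p <= d.+1)%N ->
  exists2 u : {poly R}, (size u <= d.+1)%N &
    forall t, peval p (line x q t) = u.[t].
Proof.
move=> sp.
exists (\sum_(m <- msupp p) (mcoeff m p)%:P *
   \prod_(i < n) ((tnth x i)%:P + (tnth q i) *: 'X) ^+ m i).
  apply: (leq_trans (size_sum _ _ _)); apply/bigmax_leqP_seq => m hm _.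
  have hd : (mdeg m <= d)%N by have := msize_mdeg_lt hm; move: sp; lia.
  rewrite mul_polyC (leq_trans (size_scale_leq _ _)) //.
  apply: leq_trans (_ : (\sum_(i < n) m i).+1 <= _)%N; last by rewrite ltnS -mdegE.
  elim/big_rec2: _ => [|i k u _ IH]; first by rewrite size_poly1.
  rewrite (leq_trans (size_polyMleq _ _)) //.
  have h : (size (((tnth x i)%:P + (tnth q i) *: 'X) ^+ m i) <= (m i).+1)%N.
    have hs : (size ((tnth x i)%:P + (tnth q i) *: 'X)%R <= 2)%N.
      rewrite (leq_trans (size_polyD _ _)) // geq_max size_polyC.
      by rewrite (leq_trans (leq_b1 _)) //= (leq_trans (size_scale_leq _ _)) // size_polyX.
    by rewrite (leq_trans (size_poly_exp_leq _ _)) // ltnS; move: hs; nia.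
  by move: h IH; lia.
move=> t; rewrite /peval mevalE horner_sum; apply: eq_bigr => m _.
rewrite hornerM hornerC horner_prod; congr (_ * _); apply: eq_bigr => i _.
by rewrite horner_exp !hornerE tnth_line (mulrC t).
Qed.

End PolyLine.

(** * Self-correction *)

Section SelfCorrection.
Context {R : realType} {n : nat}.
Variables (d : nat) (dl : R) (F : Rn R n -> R).

Definition interp (t : R) (x q : Rn R n) : R :=
  \sum_(i < d.+1) weight dl t i * F (line x q (node dl i)).

Definition resid (t : R) (x q : Rn R n) : R := F (line x q t) - interp t x q.

Definition scale (a : R) (x : Rn R n) : Rn R n := line origin x a.

Lemma tnth_scale a x i : tnth (scale a x) i = a * tnth x i.
Proof. by rewrite tnth_line tnth_mktuple add0r. Qed.

Hypothesis mF : measurable_fun setT F.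

Lemma measurable_weight disp (T : measurableType disp) (t : T -> R) (i : 'I_d.+1) :
  measurable_fun setT t -> measurable_fun setT (fun w => weight dl (t w) i).
Proof.
move=> mt; rewrite /weight.
under eq_fun do rewrite horner_coef.
apply: measurable_sum => k; apply: measurable_funM => //.
exact: measurable_funX.
Qed.

Lemma measurable_F_line disp (T : measurableType disp)
    (t : T -> measurableTypeR R) (x q : T -> Rn R n) :
  measurable_fun setT t -> measurable_fun setT x -> measurable_fun setT q ->
  measurable_fun setT (fun w => F (line (x w) (q w) (t w))).
Proof. by move=> mt mx mq; apply: (measurableT_comp mF); apply: measurable_line. Qed.

Lemma measurable_interp disp (T : measurableType disp)
    (t : T -> measurableTypeR R) (x q : T -> Rn R n) :
  measurable_fun setT t -> measurable_fun setT x -> measurable_fun setT q ->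
  measurable_fun setT (fun w => interp (t w) (x w) (q w)).
Proof.
move=> mt mx mq; apply: measurable_sum => k; apply: measurable_funM.
  exact: measurable_weight.
exact: measurable_F_line.
Qed.

Lemma measurable_resid disp (T : measurableType disp)
    (t : T -> measurableTypeR R) (x q : T -> Rn R n) :
  measurable_fun setT t -> measurable_fun setT x -> measurable_fun setT q ->
  measurable_fun setT (fun w => resid (t w) (x w) (q w)).
Proof.
move=> mt mx mq; apply: measurable_funB; first exact: measurable_F_line.
exact: measurable_interp.
Qed.

Lemma measurable_norm_gt disp (T : measurableType disp) (f : T -> R) (a : R) :
  measurable_fun setT f -> measurable [set w | a < `|f w|].
Proof.
move=> mf; rewrite -[X in measurable X]setTI.
have mn : measurable_fun setT (fun w => `|f w|) by exact: measurableT_comp.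
have -> : [set w | a < `|f w|] = (fun w => `|f w|) @^-1` `]a, +oo[%classic.
  by apply/seteqP; split => w /=; rewrite in_itv /= andbT.
exact: mn.
Qed.

Lemma measurable_scaled_test (tau rho : R) :
  measurable [set w : (Rn R n * Rn R n) * measurableTypeR R |
    `|w.2| <= 2 /\ tau < `|resid w.2 w.1.1 (scale rho w.1.2)|].
Proof.
rewrite (_ : mkset _ = ~` [set w : (Rn R n * Rn R n) * measurableTypeR R |
    2 < `|w.2 : R|] `&` [set w | tau < `|resid w.2 w.1.1 (scale rho w.1.2)|]);
  last by apply/seteqP; split=> w /=; rewrite leNgt => -[/negP].
apply: measurableI.
  by apply: measurableC; apply: measurable_norm_gt.
apply: measurable_norm_gt; apply: measurable_resid => //.
  exact: (measurableT_comp measurable_fst).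
apply: measurable_line => //.
exact: (measurableT_comp measurable_snd).
Qed.

Hypotheses (dl0 : 0 < dl) (dl1 : d%:R * dl <= 1) (d0 : (0 < d)%N).
Variables (tau eta xi Y : R).
Hypotheses (tau0 : 0 < tau) (Y0 : 0 < Y).

Local Notation U := (cube n).
Local Notation w0 := (@weight R d dl 0).
Local Notation A := (weight_bound d dl).
Local Notation s_ := (node dl).

(** The price, in probability, of replacing a uniform [x] by [y + s x] with [y] of size at most [Y]
    and [s] in the range of the nodes. *)
Definition perturb : R := n%:R * (2 * Y + d%:R * dl).

Lemma perturb_ge0 : 0 <= perturb.
Proof. by rewrite mulr_ge0 // addr_ge0 // mulr_ge0 // ltW. Qed.

Definition small (r : R) (x : Rn R n) := forall i, `|tnth x i| <= r.

Lemma cube_perturb (s : R) (y : Rn R n) B : 1 <= s <= 1 + d%:R * dl ->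
  small Y y -> measurable B ->
  (U ((fun x => line y x s) @^-1` B) <= U B + perturb%:E)%E.
Proof. by move=> /andP[s1 s2] hy mB; exact: cube_near_id (ltW Y0) mB. Qed.

Lemma node_range (i : 'I_d.+1) : 1 <= s_ i <= 1 + d%:R * dl.
Proof. by rewrite (node_ge1 dl0) (node_le_theta dl0). Qed.

Lemma line_line_comm (y q1 q2 : Rn R n) (a b : R) :
  line (line y q1 a) q2 b = line (line y q2 b) q1 a.
Proof. by apply: eq_from_tnth => i; rewrite !tnth_line; ring. Qed.

Hypothesis test_big :
  ((U \x U) [set w | (tau < `|resid 0 w.1 w.2|)%R] <= eta%:E)%E.
Hypothesis xi_big : 2 * d.+1%:R * (eta + perturb) < xi.

(* The values at the grid points [y + node i * q1 + node j * q2] are interpolated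
   in two ways, along rows and along columns. *)
Lemma corrected_exists (y : Rn R n) : small Y y ->
  exists c, (U [set q | (2 * A * tau < `|interp 0 y q - c|)%R] <= xi%:E)%E.
Proof.
move=> hy.
pose BA := [set w : Rn R n * Rn R n | tau < `|resid 0 w.1 w.2|].
have mBA : measurable BA by apply: measurable_norm_gt; apply: measurable_resid.
pose E (k : 'I_d.+1 + 'I_d.+1) : set (Rn R n * Rn R n) :=
  match k with
  | inl i => [set w | BA (line y w.1 (s_ i), w.2)]
  | inr i => [set w | BA (line y w.2 (s_ i), w.1)] end.
have mE1 i : measurable [set w : Rn R n * Rn R n | BA (line y w.1 (s_ i), w.2)].
  rewrite -[X in measurable X]setTI.
  by apply: (measurable_fun_pair (measurable_line _ _ _)) => //.
have mE k : measurable (E k).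
  case: k => i //=; rewrite -[X in measurable X]setTI.
  by apply: (measurable_fun_pair (measurable_line _ _ _)) => //.
have PE1 (i : 'I_d.+1) : ((U \x U) [set w | BA (line y w.1 (s_ i), w.2)] <= (eta + perturb)%:E)%E.
  have my : measurable_fun setT (fun w : Rn R n * Rn R n => line y w.1 (s_ i)).
    exact: measurable_line.
  apply: (le_trans (@prod_perturb_l R _ _ _ _ U U
    (fun _ x => line y x (s_ i)) BA setT _ mBA my perturb_ge0 measurableT _ _)).
  - by rewrite setCT measure0.
  - by move=> _ B _ mB; exact: (cube_perturb (node_range i) hy mB).
  by rewrite EFinD leeD2r.
have PE k : ((U \x U) (E k) <= (eta + perturb)%:E)%E.
  by case: k => i; have := PE1 i => //; rewrite -(prod_swap U U (mE1 i)).
have [mU PU] := union_bound_cst mE PE.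
have card : #|[the finType of ('I_d.+1 + 'I_d.+1)%type]|%:R * (eta + perturb) < xi.
  by rewrite card_sum !card_ord natrD -mulr2n -(mulr_natl d.+1%:R).
(* Some fixed column direction [q2] fails for few row directions [q1]; the value extrapolated along
   [q2] serves as the common value [c]. *)
have [q2 hq2] := exists_ysection_le mU PU card.
exists (interp 0 y q2); apply: le_trans hq2; apply: le_measure; rewrite ?inE.
- apply: measurable_norm_gt; apply: measurable_funB => //.
  exact: measurable_interp.
- exact: measurable_ysection.
move=> q1 /= hq; rewrite /ysection /= inE /=; apply: contrapT => /forallNP h.
have {}h k : ~ E k (q1, q2) by exact: h.
have hl (i : 'I_d.+1) : `|F (line y q1 (s_ i)) - interp 0 (line y q1 (s_ i)) q2| <= tau.
  by rewrite leNgt; apply/negP => ht; apply: (h (inl i)); rewrite /E /BA /= /resid line0.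
have hr (i : 'I_d.+1) : `|F (line y q2 (s_ i)) - interp 0 (line y q2 (s_ i)) q1| <= tau.
  by rewrite leNgt; apply/negP => ht; apply: (h (inr i)); rewrite /E /BA /= /resid line0.
have n02 : `|0 : R| <= 2 by rewrite normr0.
have el := weight_sum_close dl0 dl1 n02 hl.
have er := weight_sum_close dl0 dl1 n02 hr.
have ec : \sum_(i < d.+1) w0 i * interp 0 (line y q1 (s_ i)) q2 =
    \sum_(i < d.+1) w0 i * interp 0 (line y q2 (s_ i)) q1.
  under eq_bigr do rewrite mulr_sumr.
  rewrite exchange_big /=; apply: eq_bigr => i _; rewrite mulr_sumr.
  by apply: eq_bigr => j _; rewrite mulrCA line_line_comm.
move: el er; rewrite -/(interp 0 y q1) -/(interp 0 y q2) ec => el; rewrite distrC => er.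
move: hq; rewrite ltNge => /negP; apply.
rewrite -mulrA -[2 * _]/((1 + 1) * _) mulrDl mul1r.
by apply: le_trans (lerD el er); exact: ler_distD.
Qed.


Variables (g : Rn R n -> R) (rho : R).
Hypothesis corrected : forall y, small Y y ->
  (U [set q | (2 * A * tau < `|interp 0 y q - g y|)%R] <= xi%:E)%E.
Hypotheses (rho0 : 0 < rho) (rhoY : 2 * rho <= Y).

(* Same idea on the points [y + s v + node j * (q1 + s rho u)]: for fixed [s] they
   determine [g (y + s v)], and for fixed [j] they lie on a tested line. *)
Lemma corrected_line_at (t eta' : R) (y v : Rn R n) : `|t| <= 2 ->
  ((U \x U) [set w | (tau < `|resid t w.1 (scale rho w.2)|)%R] <= eta'%:E)%E ->
  (forall s, `|s| <= 2 -> small Y (line y v s)) -> small (rho * Y) v ->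
  d.+2%:R * (xi + perturb) + d.+1%:R * (eta' + 2 * perturb) < 1 ->
  `|g (line y v t) - \sum_(i < d.+1) weight dl t i * g (line y v (s_ i))|
    <= (3 * A + 2 * A ^+ 2) * tau.
Proof.
move=> t2 ht hyv hv hlt1.
have k0 := perturb_ge0.
have hy : small Y y by rewrite -(line0 y v); apply: hyv; rewrite normr0.
(* The [d + 2] parameters at which [g] is evaluated: the nodes, and [t] itself as [None]. *)
pose sg (k : option 'I_d.+1) : R := if k is Some i then s_ i else t.
have sg2 k : `|sg k| <= 2.
  case: k => [i|] //=; rewrite ger0_norm ?(node_le2 dl0) //.
  by rewrite (le_trans _ (node_ge1 dl0 i)).
pose Bs (s : R) := [set q | 2 * A * tau < `|interp 0 (line y v s) q - g (line y v s)|].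
have mBs s : measurable (Bs s).
  by apply: measurable_norm_gt; apply: measurable_funB => //; exact: measurable_interp.
pose Ea k := [set w : Rn R n * Rn R n | Bs (sg k) (line w.1 (scale rho w.2) (sg k))].
have mscale (a : R) : measurable_fun setT (fun w : Rn R n * Rn R n => scale a w.2).
  exact: measurable_line.
have mfa s : measurable_fun setT
    (fun w : Rn R n * Rn R n => line w.1 (scale rho w.2) s).
  by apply: measurable_line => //; exact: mscale.
have mEa k : measurable (Ea k).
  by rewrite -[X in measurable X]setTI; apply: mfa.
have PEa k : ((U \x U) (Ea k) <= (xi + perturb)%:E)%E.
  (* For [u] in the cube, adding [sg k * rho * u] is a translation by at most [2 * rho <= Y],
     whatever the parameter; no dilation is involved. *)
  have [mG G0] := @cube_support R n.
  have mBT : measurable (Bs (sg k) `*` [set: Rn R n]) by exact: measurableX.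
  have := @prod_perturb_l R _ _ _ _ U U
    (fun u x => line x (scale rho u) (sg k)) _ _ _ mBT (mfa (sg k)) k0 mG G0.
  rewrite product_measure1E // [X in (_ * X + _)%E]probability_setT mule1.
  have -> : [set w | (Bs (sg k) `*` [set: Rn R n])
     (line w.1 (scale rho w.2) (sg k), w.2)] = Ea k.
    by apply/seteqP; split=> w //= [].
  move=> h; apply: (le_trans (h _)) => {h}.
    move=> u B hu mB.
    have -> : (fun x => line x (scale rho u) (sg k)) =
        (fun x => line (scale (sg k * rho) u) x 1).
      apply/funext => x; apply: eq_from_tnth => i.
      by rewrite !tnth_line !tnth_mktuple; ring.
    apply: cube_perturb => //; first by rewrite lexx lerDl mulr_ge0 // ltW.
    move=> i; rewrite tnth_scale !normrM (gtr0_norm rho0).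
    have /andP[u0 u1] := hu i; rewrite (ger0_norm u0).
    apply: le_trans rhoY; rewrite -mulrA ler_pM // ?mulr_ge0 ?(ltW rho0) //.
    by rewrite ler_piMr // ltW.
  by rewrite EFinD leeD2r //; apply: corrected; apply: hyv; exact: sg2.
pose BC := [set w : Rn R n * Rn R n | tau < `|resid t w.1 (scale rho w.2)|].
have mBC : measurable BC.
  by apply: measurable_norm_gt; apply: measurable_resid => //; exact: mscale.
(* Absorbs [v] into the tested direction: [v + s rho u = rho (v' + s u)], and [v' + s u] is almost
   uniform when [s] is a node, since [v'] has size at most [Y]. *)
pose v' := scale rho^-1 v.
have hv' : small Y v'.
  move=> i; rewrite tnth_scale normrM normfV (gtr0_norm rho0).
  by rewrite ler_pdivrMl // hv.
pose A1 (j : 'I_d.+1) := [set w : Rn R n * Rn R n | BC (line y w.1 (s_ j), w.2)].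
pose Eb (j : 'I_d.+1) := [set w : Rn R n * Rn R n | A1 j (w.1, line v' w.2 (s_ j))].
have ml1 z (j : 'I_d.+1) : measurable_fun setT
    (fun w : Rn R n * Rn R n => line z w.1 (s_ j)) by exact: measurable_line.
have ml2 z (j : 'I_d.+1) : measurable_fun setT
    (fun w : Rn R n * Rn R n => line z w.2 (s_ j)) by exact: measurable_line.
have mA1 j : measurable (A1 j).
  rewrite -[X in measurable X]setTI.
  by apply: (measurable_fun_pair (ml1 y j)).
have mEb j : measurable (Eb j).
  rewrite -[X in measurable X]setTI.
  by apply: (measurable_fun_pair _ (ml2 v' j)).
have PEb j : ((U \x U) (Eb j) <= (eta' + 2 * perturb)%:E)%E.
  have h1 := @prod_perturb_l R _ _ _ _ U U (fun _ x => line y x (s_ j)) BC setT _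
    mBC (ml1 y j) k0 measurableT.
  have h2 := @prod_perturb_r R _ _ _ _ U U (fun _ x => line v' x (s_ j)) (A1 j) _
    (mA1 j) (ml2 v' j) k0.
  apply: (le_trans (h2 _)).
    by move=> _ B mB; exact: (cube_perturb (node_range j) hv' mB).
  have -> : (eta' + 2 * perturb)%:E = (eta'%:E + perturb%:E + perturb%:E)%E.
    by rewrite -!EFinD; congr (_%:E); ring.
  apply: leeD => //; apply: (le_trans (h1 _ _)).
  - by rewrite setCT measure0.
  - by move=> _ B _ mB; exact: (cube_perturb (node_range j) hy mB).
  by rewrite leeD2r.
have [mUa PUa] := union_bound_cst mEa PEa.
have [mUb PUb] := union_bound_cst mEb PEb.
have : ((U \x U) ([set w | exists k, Ea k w] `|` [set w | exists j, Eb j w]) < 1)%E.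
  apply: (le_lt_trans (measureU2 _ mUa mUb)).
  apply: (le_lt_trans (leeD PUa PUb)).
  by rewrite card_option !card_ord -EFinD lte_fin.
move=> /exists_notin [[q1 u]] /= /not_orP [/forallNP na /forallNP nb].
pose q2 := scale rho u.
have ha k : `|interp 0 (line y v (sg k)) (line q1 q2 (sg k)) - g (line y v (sg k))|
    <= 2 * A * tau by rewrite leNgt; apply/negP => h; exact: (na k).
pose X (j : 'I_d.+1) := line y q1 (s_ j).
pose V (j : 'I_d.+1) := line v q2 (s_ j).
have hV (j : 'I_d.+1) : scale rho (line v' u (s_ j)) = V j.
  apply: eq_from_tnth => i; rewrite !tnth_line !tnth_mktuple.
  by field; rewrite gt_eqF.
have hb j : `|F (line (X j) (V j) t) - interp t (X j) (V j)| <= tau.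
  rewrite leNgt; apply/negP => h; apply: (nb j).
  by rewrite /Eb /A1 /BC /= /resid hV.
have hswap s (j : 'I_d.+1) :
    line (line y v s) (line q1 q2 s) (s_ j) = line (X j) (V j) s.
  by apply: eq_from_tnth => i; rewrite !tnth_line; ring.
have n02 : `|0 : R| <= 2 by rewrite normr0.
have e1 := weight_sum_close dl0 dl1 n02 hb.
have e2 := weight_sum_close dl0 dl1 t2 (fun i => ha (Some i)).
have e3 := ha None.
have eL : interp 0 (line y v t) (line q1 q2 t) =
    \sum_(j < d.+1) w0 j * F (line (X j) (V j) t).
  by apply: eq_bigr => j _; rewrite hswap.
have eR : \sum_(j < d.+1) w0 j * interp t (X j) (V j) =
    \sum_(i < d.+1) weight dl t i *
      interp 0 (line y v (s_ i)) (line q1 q2 (s_ i)).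
  under eq_bigr do rewrite mulr_sumr.
  rewrite exchange_big /=; apply: eq_bigr => i _; rewrite mulr_sumr.
  by apply: eq_bigr => j _; rewrite mulrCA hswap.
move: e1 e2 e3; rewrite /= -eL eR distrC => e1 e2; rewrite distrC => e3.
set a := g _ in e3 *; set b := interp 0 _ _ in e1 e3.
set c := \sum_(i < _) _ in e1 e2; set e := \sum_(i < _) _ in e2 *.
(* The three differences come from the corrected value at [t], from the tested lines, and from the
   corrected values at the nodes, weighted once more. *)
have -> : a - e = (a - b) + (b - c) + (c - e) by ring.
apply: (le_trans (ler_normD _ _)); apply: (le_trans (lerD (ler_normD _ _) (lexx _))).
have -> : (3 * A + 2 * A ^+ 2) * tau = 2 * A * tau + A * tau + A * (2 * A * tau).
  by ring.
by apply: lerD => //; apply: lerD => //; rewrite distrC.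
Qed.


(* The test with random [t] only gives the estimate for most [t], independently of
   [y] and [v]; an arbitrary [t] is reached by interpolating from good parameters
   [t + node k * r].  Without random real parameters, additive functions that are
   not linear would pass the tests. *)
Lemma corrected_line (eta' t : R) (y v : Rn R n) : Y <= 1 / 2 -> 0 < eta' ->
  ((U \x U) [set w | (tau < `|resid 0 w.1 (scale rho w.2)|)%R] <= eta'%:E)%E ->
  ((U \x U \x unif01)
    [set w | (`|w.2| <= 2)%R /\
      (tau < `|resid w.2 w.1.1 (scale rho w.1.2)|)%R] <= eta%:E)%E ->
  d.+2%:R * (xi + perturb) + d.+1%:R * (eta' + 2 * perturb) < 1 ->
  4 * d.+1%:R * eta < eta' ->
  small (Y / 2) y -> small (rho * Y) v -> `|t| <= 1 / 8 ->
  `|g (line y v t) - \sum_(i < d.+1) weight dl t i * g (line y v (s_ i))|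
    <= (1 + A) * ((3 * A + 2 * A ^+ 2) * tau).
Proof.
move=> Y1 eta'0 test0 testt hlt1 heta hy hv ht.
pose BC := [set w : (Rn R n * Rn R n) * measurableTypeR R |
  `|w.2| <= 2 /\ tau < `|resid w.2 w.1.1 (scale rho w.1.2)|].
have mBC : measurable BC by exact: measurable_scaled_test.
pose UU : probability (Rn R n * Rn R n)%type R := (U \x U)%E.
(* Markov's inequality bounds the measure of these parameters by [eta / eta']. *)
pose bad := [set s : measurableTypeR R | (eta'%:E < UU (ysection BC s))%E].
have mbad : measurable bad.
  have -> : bad = [set: measurableTypeR R] `&`
      (fun s => UU (ysection BC s)) @^-1` `]eta'%:E, +oo[%classic.
    by apply/seteqP; split=> s /=; rewrite in_itv /= andbT; [|case].
  exact: (measurable_fun_ysection UU mBC measurableT (emeasurable_itv _)).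
have Pbad : (eta'%:E * unif01 bad <= eta%:E)%E.
  apply: le_trans testt; apply: prod_ge_of_ysection => //; first exact: ltW.
  by move=> s /ltW.
(* This is [t + s_ k * (r / 4 + 1 / 8)]. For [r] in the unit interval and [|t| <= 1 / 8] it stays in
   the unit interval, so no mass is lost, and its slope is at least 1/4, so the measure of [bad]
   grows at most fourfold. *)
pose aff (k : 'I_d.+1) (r : R) := s_ k / 4 * r + (t + s_ k / 8).
have s1 (k : 'I_d.+1) := node_ge1 dl0 k.
have s2 (k : 'I_d.+1) := node_le2 dl0 dl1 k.
have [t1 t2] : - (1 / 8) <= t /\ t <= 1 / 8 by move: ht; rewrite ler_norml => /andP[].
have maff k : measurable (aff k @^-1` bad).
  by rewrite -[X in measurable X]setTI; apply: measurable_affine.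
have Paff k : (unif01 (aff k @^-1` bad) <= (4 * eta / eta')%:E)%E.
  have s0 : 0 < s_ k / 4 by have := s1 k; lra.
  apply: (le_trans (unif01_affine (t + s_ k / 8) s0 mbad)).
  rewrite (_ : _ `\` _ = set0) ?measure0 ?adde0; last first.
    rewrite -subset0 => r [] /=; rewrite !in_itv /= => /andP[r0 r1]; apply.
    by have := s1 k; have := s2 k => h1 h2; apply/andP; split; nra.
  apply: (@le_trans _ _ (4%:E * unif01 bad)%E).
    rewrite lee_wpmul2r // lee_fin invf_div ler_pdivrMr; have := s1 k; lra.
  rewrite -(@lee_pmul2l _ eta'%:E) ?lte_fin // muleCA.
  apply: (@le_trans _ _ (4%:E * eta%:E)%E); first by rewrite lee_wpmul2l.
  by rewrite -!EFinM lee_fin mulrCA divff ?mulr1 // gt_eqF.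
have [mU PU] := union_bound_cst (P := unif01) maff Paff.
have out0 : (unif01 (~` `[0%R, 1%R]%classic) <= 0 :> \bar R)%E.
  by rewrite unif01E ?setICl ?measure0 //; exact: measurableC.
have : (unif01 ([set r | exists k, (aff k @^-1` bad) r] `|` ~` `[0%R, 1%R]%classic) < 1)%E.
  apply: (le_lt_trans (measureU2 _ mU (measurableC (measurable_itv _)))).
  apply: (le_lt_trans (leeD PU out0)).
  rewrite adde0 card_ord lte_fin mulrA ltr_pdivrMr // mul1r.
  by rewrite mulrA (mulrC _ 4).
move=> /exists_notin [r' /= /not_orP [/forallNP hr /contrapT]].
rewrite in_itv /= => /andP[r'0 r'1].
pose r := r' / 4 + 1 / 8.
have [r0 r1] : 1 / 8 <= r /\ r <= 3 / 8 by rewrite /r; split; lra.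
have affE k : aff k r' = t + s_ k * r by rewrite /aff /r; field.
have hyv (y' v' : Rn R n) (c : R) : `|c| <= 2 -> small (Y / 2) y' -> small (rho * Y) v' ->
    small Y (line y' v' c).
  move=> c2 hy' hv' i; rewrite tnth_line (le_trans (ler_normD _ _)) // normrM.
  have := hy' i; have := hv' i => h1 h2.
  have : `|c| * `|tnth v' i| <= 2 * (rho * Y) by rewrite ler_pM.
  have : 2 * (rho * Y) <= 1 / 2 * Y by rewrite mulrA ler_pM2r // (le_trans rhoY).
  lra.
have tle2 (k : 'I_d.+1) : `|t + s_ k * r| <= 2.
  by have := s1 k; have := s2 k => h1 h2; rewrite ler_norml; apply/andP; split; nra.
have eta'1 : 0 <= (3 * A + 2 * A ^+ 2) * tau.
  have := weight_bound_ge1 dl0 dl1 d0 => h; have := tau0; nra.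
have claim (k : 'I_d.+1) : `|g (line y v (t + s_ k * r)) -
    \sum_(i < d.+1) weight dl (t + s_ k * r) i * g (line y v (s_ i))|
    <= (3 * A + 2 * A ^+ 2) * tau.
  apply: (@corrected_line_at _ eta') => //; last by move=> c c2; exact: hyv.
  have /negP := hr k; rewrite -leNgt affE.
  suff -> : ysection BC (t + s_ k * r) =
    [set w | tau < `|resid (t + s_ k * r) w.1 (scale rho w.2)|] by [].
  apply/seteqP; split => w; rewrite /ysection /= inE /=; first by case.
  by move=> h; split=> //; exact: tle2.
have eline (c : R) : line (line y v t) (scale r v) c = line y v (t + c * r).
  by apply: eq_from_tnth => i; rewrite !tnth_line !tnth_mktuple; ring.
have n02 : `|0 : R| <= 2 by rewrite normr0.
(* Since the parameter 0 has a test of its own, [t] can be moved into the base point: [y + t v] is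
   extrapolated along the direction [r v]. *)
have claim0 : `|g (line y v t) -
    \sum_(k < d.+1) w0 k * g (line y v (t + s_ k * r))|
    <= (3 * A + 2 * A ^+ 2) * tau.
  have := @corrected_line_at 0 eta' (line y v t) (scale r v) n02 test0.
  rewrite eline mul0r addr0; under eq_bigr do rewrite eline.
  apply => //.
  - move=> c c2; rewrite eline; apply: hyv => //.
    move: c2; rewrite ler_norml => /andP[c1 c2].
    by rewrite ler_norml; apply/andP; split; nra.
  - move=> i; rewrite tnth_scale normrM ger0_norm; last lra.
    by apply: le_trans (hv i); rewrite ler_piMl //; lra.
have e1 := weight_sum_close dl0 dl1 n02 claim.
have eW : \sum_(k < d.+1) w0 k *
     (\sum_(i < d.+1) weight dl (t + s_ k * r) i * g (line y v (s_ i))) =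
     \sum_(i < d.+1) weight dl t i * g (line y v (s_ i)).
  under eq_bigr do rewrite mulr_sumr.
  rewrite exchange_big /=; apply: eq_bigr => i _.
  under eq_bigr do rewrite mulrA.
  by rewrite -mulr_suml weight_affine.
rewrite eW in e1; rewrite mulrDl mul1r.
exact: le_trans (ler_distD _ _ _) (lerD claim0 e1).
Qed.

End SelfCorrection.

(** * From approximate polynomials on lines to one polynomial of degree [d] *)

Section CoefBound.
Context {R : realType}.

(** Multiplying by [X - a] with [|a| <= 1] at most doubles the largest coefficient. *)
Lemma coef_prod_XsubC_le (I : eqType) (s : seq I) (P : pred I) (x : I -> R) k :
  (forall i, `|x i| <= 1) ->
  `|(\prod_(i <- s | P i) ('X - (x i)%:P))`_k| <= 2 ^+ count P s.
Proof.
move=> hx; elim: s k => [|i s IH] k.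
  by rewrite big_nil coef1 normr_nat expr0 lern1 leq_b1.
rewrite big_cons /=; case: ifP => _; last by rewrite add0n.
rewrite exprS mulrBl coefB coefXM coefCM -[X in X * 2 ^+ _]/(1 + 1) mulrDl mul1r.
apply: (le_trans (ler_normB _ _)); apply: lerD.
  by case: ifP => _; rewrite ?normr0 ?exprn_ge0.
by rewrite normrM -[leRHS]mul1r ler_pM.
Qed.

(** Lagrange interpolation at the points [j / (8 N)], which fill [[0, 1/8]]: the denominators are at
    least [(8 N) ^ (- N)] and the numerators have coefficients at most [2 ^ N]. *)
Lemma coef_le (N : nat) (p : {poly R}) (K : R) k : (0 < N)%N ->
  (size p <= N.+1)%N -> (forall t, `|t| <= 1 / 8 -> `|p.[t]| <= K) ->
  `|p`_k| <= N.+1%:R * (16 * N%:R) ^+ N * K.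
Proof.
move=> N0 sp hp.
pose e : R := (8 * N%:R)^-1.
have N0' : 0 < N%:R :> R by rewrite ltr0n.
have e0 : 0 < e by rewrite invr_gt0 mulr_gt0.
pose x (j : nat) : R := j%:R * e.
have xinj : injective x.
  by move=> i j /(mulIf (lt0r_neq0 e0)) /eqP; rewrite eqr_nat => /eqP.
have x8 (j : 'I_N.+1) : `|x j| <= 1 / 8.
  rewrite ger0_norm ?mulr_ge0 // ?(ltW e0) // /x /e.
  rewrite ler_pdivrMr ?mulr_gt0 //.
  have : j%:R <= N%:R :> R by rewrite ler_nat -ltnS.
  lra.
have K0 : 0 <= K by apply: le_trans (hp 0 _); rewrite // normr0; lra.
rewrite (lagrange_gen (ltn0Sn N) xinj sp) coef_sum.
apply: (le_trans (ler_norm_sum _ _ _)).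
have -> : N.+1%:R * (16 * N%:R) ^+ N * K = \sum_(j < N.+1) (16 * N%:R) ^+ N * K.
  by rewrite sumr_const card_ord -mulrA (mulr_natl _ N.+1).
apply: ler_sum => j _; rewrite coefCM normrM mulrC.
apply: ler_pM => //; last exact: hp.
rewrite (lagrangeE (ltn0Sn N) xinj) /= coefCM normrM normfV horner_prod normr_prod.
have cardj : #|[pred i : 'I_N.+1 | i != j]| = N.
  have := cardC1 j; rewrite card_ord => /= h; apply: etrans h.
  by apply: eq_card => i; rewrite !inE.
have -> : 16 * N%:R = e^-1 * 2 :> R by rewrite /e invrK; ring.
rewrite exprMn; apply: ler_pM => //; first by rewrite invr_ge0 prodr_ge0.
  rewrite exprVn lef_pV2 ?posrE ?exprn_gt0 //; last first.
    apply: prodr_gt0 => i ij; rewrite normr_gt0 hornerXsubC subr_eq0.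
    by rewrite (inj_eq xinj) eq_sym.
  have prod_cst (c : R) : \prod_(i < N.+1 | i != j) c = c ^+ N.
    by rewrite prodr_const cardj.
  rewrite -prod_cst; apply: ler_prod => i ij; rewrite (ltW e0) /= hornerXsubC.
  rewrite /x -mulrBl normrM (gtr0_norm e0) ler_peMl ?(ltW e0) //.
  have ij' : (j : nat) != i by rewrite eq_sym.
  have [lij|lij] := leqP j i.
    by rewrite distrC -natrB // normr_nat ler1n subn_gt0 ltn_neqAle ij' lij.
  by rewrite -natrB ?(ltnW lij) // normr_nat ler1n subn_gt0.
have h := @coef_prod_XsubC_le _ (index_enum 'I_N.+1) (fun i => i != j)
  (fun i : 'I_N.+1 => x i) k.
rewrite -sum1_count sum1_card cardj in h.
by apply: h => i; apply: le_trans (x8 i) _; lra.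
Qed.

End CoefBound.

Section Polynomials.
Context {R : realType} {n : nat}.
Implicit Types (p : mpoly n R) (x y z v : Rn R n).

Lemma peval_sum (I : Type) (s : seq I) (P : pred I) (F : I -> mpoly n R) x :
  peval (\sum_(i <- s | P i) F i) x = \sum_(i <- s | P i) peval (F i) x.
Proof. by rewrite /peval raddf_sum. Qed.

Lemma msize_sum_le (I : Type) (s : seq I) (P : pred I) (F : I -> mpoly n R) k :
  (forall i, P i -> (msize (F i) <= k)%N) ->
  (msize (\sum_(i <- s | P i) F i)%R <= k)%N.
Proof.
move=> h; elim/big_rec: _ => [|i p Pi IH]; first by rewrite msize0.
by apply: leq_trans (msizeD_le _ _) _; rewrite geq_max h.
Qed.

Lemma poly_of_coord (u : {poly R}) (k : 'I_n) (c : R) d : (size u <= d.+1)%N ->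
  exists2 p, (msize p <= d.+1)%N & forall y, peval p y = u.[c * tnth y k].
Proof.
move=> su.
exists (\sum_(e < d.+1) (u`_e * c ^+ e) *: mpolyX R (mnm_muln (mnm1 k) e)).
  apply: msize_sum_le => e _; apply: leq_trans (msizeZ_le _ _) _.
  rewrite msizeX mdegMn mdeg1 mul1n; exact: ltn_ord.
move=> y; rewrite peval_sum (horner_coef_wide _ su); apply: eq_bigr => e _.
rewrite /peval mevalZ mevalX exprMn mulrA; congr (_ * _).
rewrite (bigD1 k) //= mulmnE mnm1E eqxx mul1n big1 ?mulr1 // => i ik.
by rewrite mulmnE mnm1E eq_sym (negPf ik) mul0n expr0.
Qed.

Definition set_coord (y : Rn R n) (k : 'I_n) (c : R) : Rn R n :=
  [tuple (if i == k then c else tnth y i : R) | i < n].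

Lemma tnth_set_coord y k c i :
  tnth (set_coord y k c) i = if i == k then c else tnth y i.
Proof. by rewrite tnth_mktuple. Qed.

(* The coordinates of index at least [j] are frozen at those of [z]; the second
   clause says that [p] does not mention them. *)
Definition poly_in (j D : nat) (f : Rn R n -> R) := forall z, exists p,
  [/\ (msize p <= D.+1)%N,
      forall y y', (forall k : 'I_n, (k < j)%N -> tnth y k = tnth y' k) ->
        peval p y = peval p y' &
      forall y, (forall k : 'I_n, (j <= k)%N -> tnth y k = tnth z k) ->
        f y = peval p y].

Lemma poly_in0 f : poly_in 0 0 f.
Proof.
move=> z; exists (mpolyC n (f z)); split.
- by rewrite msizeC; case: eqP.
- by move=> y y' _; rewrite /peval !mevalC.
by move=> y h; rewrite /peval mevalC; congr f; apply: eq_from_tnth => k; exact: h.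
Qed.

Variables (d : nat) (dl : R).
Hypotheses (d0 : (0 < d)%N) (dl0 : 0 < dl) (dl1 : d%:R * dl <= 1).
Local Notation A := (weight_bound d dl).
Local Notation s_ := (node dl).

Definition interp_coord (lam : R) (k : 'I_n) (f : Rn R n -> R) (y : Rn R n) : R :=
  \sum_(i < d.+1) weight dl (tnth y k / lam) i * f (set_coord y k (lam * s_ i)).

Lemma poly_in_interp (lam : R) (k : 'I_n) D f :
  poly_in k D f -> poly_in k.+1 (d + D) (interp_coord lam k f).
Proof.
move=> hf z.
have /choice[p hp] : forall i : 'I_d.+1, exists p, [/\ (msize p <= D.+1)%N,
   forall y y', (forall l : 'I_n, (l < k)%N -> tnth y l = tnth y' l) ->
        peval p y = peval p y' &
   forall y, (forall l : 'I_n, (k <= l)%N -> tnth y l =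
       tnth (set_coord z k (lam * s_ i)) l) -> f y = peval p y].
  by move=> i; exact: hf.
have /choice[W hW] : forall i : 'I_d.+1, exists W : mpoly n R,
    (msize W <= d.+1)%N /\ forall y, peval W y = (lag dl i).[lam^-1 * tnth y k].
  move=> i; have [W h1 h2] := poly_of_coord k lam^-1 (size_lag dl0 i).
  by exists W.
exists (\sum_(i < d.+1) W i * p i); split.
- apply: msize_sum_le => i _.
  have [hp1 _ _] := hp i; have [hW1 _] := hW i.
  have [->|W0] := eqVneq (W i) 0; first by rewrite mul0r msize0.
  have [->|p0] := eqVneq (p i) 0; first by rewrite mulr0 msize0.
  rewrite msizeM //; move: (msize (p i)) (msize (W i)) hp1 hW1 => a c; lia.
- move=> y y' h; rewrite !peval_sum; apply: eq_bigr => i _.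
  rewrite /peval !mevalM -!/(peval _ _) !(hW i).2 h //; congr (_ * _).
  by have [_ h2 _] := hp i; apply: h2 => l lk; apply: h; rewrite ltnS ltnW.
move=> y h; rewrite /interp_coord peval_sum; apply: eq_bigr => i _.
have [_ h2 h3] := hp i.
rewrite /peval mevalM -!/(peval _ _) (hW i).2 /weight mulrC (mulrC _ (tnth y k)) mulrC.
congr (_ * _); rewrite h3; last first.
  move=> l kl; rewrite !tnth_set_coord; case: eqP => // lk; apply: h.
  by rewrite ltn_neqAle kl andbT; apply/eqP => e; apply: lk; apply/val_inj.
by apply: h2 => l lk; rewrite tnth_set_coord; case: eqP => // e; move: lk; rewrite e ltnn.
Qed.

Variables (g : Rn R n -> R) (b K : R).
Hypotheses (b0 : 0 < b) (K0 : 0 <= K).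
Hypothesis g_line : forall y v t, small b y -> small b v -> `|t| <= 1 / 8 ->
  `|g (line y v t) - \sum_(i < d.+1) weight dl t i * g (line y v (s_ i))| <= K.

(** The induction hypothesis is applied at points whose [j]-th coordinate is a rescaled node, which
    can be as large as [b]; hence only the coordinates already interpolated are required to be below
    [b / 16]. The error obeys [e (j + 1) <= K + A * e j]. *)
Lemma interp_coords j : (j <= n)%N -> exists2 H, poly_in j (d * j) H &
  forall y, small b y -> (forall k : 'I_n, (k < j)%N -> `|tnth y k| <= b / 16) ->
    `|g y - H y| <= K * j%:R * A ^+ j.
Proof.
have A1 := weight_bound_ge1 dl0 dl1 d0.
elim: j => [_|j IH jn].
  exists g; first by rewrite muln0; exact: poly_in0.
  by move=> y _ _; rewrite subrr normr0 mulr0 mul0r.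
have [H hH hgH] := IH (ltnW jn).
pose k := Ordinal jn.
(* Nodes are at most 2, so the rescaled nodes stay below [b], while a coordinate of size [b / 16]
   becomes a parameter of size at most 1/8. *)
pose lam := b / 2.
have lam0 : 0 < lam by rewrite divr_gt0.
exists (interp_coord lam k H).
  by rewrite mulnS; apply: (@poly_in_interp lam k).
move=> y hy hyk.
pose t := tnth y k / lam.
have t8 : `|t| <= 1 / 8.
  rewrite normrM normfV (gtr0_norm lam0) ler_pdivrMr //.
  apply: le_trans (hyk k (ltnSn j)) _; by rewrite /lam; lra.
have t2 : `|t| <= 2 by apply: le_trans t8 _; lra.
pose y0 := set_coord y k 0.
pose v := set_coord origin k lam.
have el c : line y0 v c = set_coord y k (c * lam).
  apply: eq_from_tnth => i; rewrite tnth_line !tnth_set_coord tnth_mktuple.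
  by case: ifP => _; rewrite ?add0r // mulr0 addr0.
have ey : line y0 v t = y.
  rewrite el; apply: eq_from_tnth => i; rewrite tnth_set_coord.
  by case: eqP => [->|//]; rewrite /t divfK // gt_eqF.
have h1 : `|g y - \sum_(i < d.+1) weight dl t i * g (set_coord y k (lam * s_ i))| <= K.
  have := @g_line y0 v t _ _ t8; rewrite ey.
  under eq_bigr do rewrite el mulrC.
  under [in X in _ -> X]eq_bigr do rewrite mulrC (mulrC lam).
  apply.
  - by move=> i; rewrite tnth_set_coord; case: ifP => _ //; rewrite normr0 ltW.
  move=> i; rewrite tnth_set_coord tnth_mktuple; case: ifP => _.
    by rewrite (gtr0_norm lam0) /lam ler_pdivrMr // ler_peMr ?(ltW b0) // ler1n.
  by rewrite normr0 ltW.
have h2 (i : 'I_d.+1) : `|g (set_coord y k (lam * s_ i)) -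
    H (set_coord y k (lam * s_ i))| <= K * j%:R * A ^+ j.
  have s1 := node_ge1 dl0 i; have s2 := node_le2 dl0 dl1 i.
  apply: hgH.
    move=> l; rewrite tnth_set_coord; case: ifP => // _.
    rewrite ger0_norm; last by rewrite mulr_ge0 ?(ltW lam0) // (le_trans _ s1).
    have : lam * s_ i <= lam * 2 by rewrite ler_pM2l.
    by rewrite /lam; lra.
  move=> l lj; rewrite tnth_set_coord; case: eqP => [e|_].
    by move: lj; rewrite e /= ltnn.
  by apply: hyk; rewrite ltnS ltnW.
have h3 := weight_sum_close dl0 dl1 t2 h2.
apply: le_trans (ler_distD _ _ _) (le_trans (lerD h1 h3) _).
have Aj : 1 <= A ^+ j.+1 by rewrite exprn_ege1.
have -> : A * (K * j%:R * A ^+ j) = K * j%:R * A ^+ j.+1 by rewrite exprS; ring.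
rewrite -natr1 mulrDr mulr1 mulrDl addrC lerD2l.
by rewrite ler_peMr.
Qed.

Hypothesis n0 : (0 < n)%N.

(** The first term is the loss of the coordinatewise interpolation. In the second, which accounts
    for the dropped monomials, one factor [(d * n).+1] and the power come from [coef_le], and the
    other factor from adding up the coefficients. *)
Definition approx_factor : R := n%:R * A ^+ n +
  (d * n).+1%:R ^+ 2 * (16 * (d * n)%:R) ^+ (d * n) * (n%:R * A ^+ n + 1).

(* Interpolating one coordinate at a time gives a polynomial of degree at most
   [d * n].  On every line through the origin [g] is close to a polynomial of
   degree at most [d], so the monomials of degree above [d] contribute little and
   can be dropped. *)
Lemma poly_approx : exists2 p, (msize p <= d.+1)%N &
  forall y, small (b / 16) y -> `|g y - peval p y| <= K * approx_factor.
Proof.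
have [H hH hgH] := interp_coords (leqnn n).
have [p0 [sp0 _ hp0]] := hH origin.
set N := (d * n)%N in sp0.
have N0 : (0 < N)%N by rewrite muln_gt0 d0.
have gp0 y : small (b / 16) y -> `|g y - peval p0 y| <= K * n%:R * A ^+ n.
  move=> hy; rewrite -hp0; last by move=> k; rewrite leqNgt ltn_ord.
  by apply: hgH => // i; apply: le_trans (hy i) _; have := b0; lra.
pose p := \sum_(m <- msupp p0 | (mdeg m <= d)%N) mcoeff m p0 *: mpolyX R m.
have sp : (msize p <= d.+1)%N.
  apply: msize_sum_le => m hm; apply: leq_trans (msizeZ_le _ _) _.
  by rewrite msizeX.
(* Stretching by 8 puts [y] at the parameter 1/8, the end of the interval on which the line estimate
   holds. *)
exists p => // y hy; pose v := scale 8 y.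
have ev t : line origin v t = scale (t * 8) y.
  by apply: eq_from_tnth => i; rewrite !tnth_line !tnth_mktuple; ring.
have eyv : line origin v (1 / 8) = y.
  by rewrite ev; apply: eq_from_tnth => i; rewrite tnth_scale divfK ?mul1r.
have [ul sul hul] := poly_on_line origin v sp.
(* The dropped part of [p0] along the line: its coefficient of degree [k] is the homogeneous part of
   degree [k] at [v]. *)
pose uh : {poly R} := \sum_(m <- msupp p0 | ~~ (mdeg m <= d)%N)
  (mcoeff m p0 * \prod_(i < n) tnth v i ^+ m i) *: 'X^(mdeg m).
have suh : (size uh <= N.+1)%N.
  apply: (leq_trans (size_sum _ _ _)); apply/bigmax_leqP_seq => m hm _.
  apply: leq_trans (size_scale_leq _ _) _; rewrite size_polyXn.
  by apply: leq_trans sp0; exact: msize_mdeg_lt.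
have hlow k : (k <= d)%N -> uh`_k = 0.
  move=> kd; rewrite coef_sum big1 // => m; rewrite -ltnNge => dm.
  by rewrite coefZ coefXn ltn_eqF ?mulr0 // (leq_ltn_trans kd).
have huh t : peval p0 (line origin v t) - peval p (line origin v t) = uh.[t].
  rewrite peval_sum [peval p0 _]mevalE (bigID (fun m => mdeg m <= d)%N) /=.
  rewrite addrAC (_ : _ - _ = 0) ?add0r; last first.
    apply/eqP; rewrite subr_eq0; apply/eqP; apply: eq_bigr => m _.
    by rewrite /peval mevalZ mevalX.
  rewrite horner_sum; apply: eq_bigr => m _.
  rewrite hornerZ hornerXn -mulrA; congr (_ * _).
  rewrite mdegE expr_sum -big_split /=; apply: eq_bigr => i _.
  by rewrite tnth_line tnth_mktuple add0r mulrC exprMn.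
pose P : {poly R} := \sum_(i < d.+1) g (line origin v (s_ i)) *: lag dl i.
have sP : (size P <= d.+1)%N.
  apply: (leq_trans (size_sum _ _ _)); apply/bigmax_leqP_seq => i _ _.
  by apply: leq_trans (size_scale_leq _ _) _; exact: size_lag.
have PE t : P.[t] = \sum_(i < d.+1) weight dl t i * g (line origin v (s_ i)).
  by rewrite horner_sum; apply: eq_bigr => i _; rewrite hornerZ mulrC.
(* [p0] and the interpolant [P] are both close to [g] for [|t| <= 1 / 8], so [psi] has small
   coefficients; above degree [d] these are the coefficients of [uh], because [ul] and [P] stop at
   [d]. *)
pose psi := uh + ul - P.
have dN : (d <= N)%N by rewrite leq_pmulr.
have spsi : (size psi <= N.+1)%N.
  apply: leq_trans (size_polyD _ _) _; rewrite size_polyN geq_max.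
  rewrite (leq_trans sP) // andbT; apply: leq_trans (size_polyD _ _) _.
  by rewrite geq_max suh (leq_trans sul).
have hv : small b v.
  move=> i; rewrite tnth_scale normrM ger0_norm //.
  by have := hy i; have := b0; lra.
have horig : small b (origin : Rn R n).
  by move=> i; rewrite tnth_mktuple normr0 ltW.
have hpsi t : `|t| <= 1 / 8 -> `|psi.[t]| <= K * (n%:R * A ^+ n + 1).
  move=> ht; rewrite !hornerE -huh -hul subrK PE.
  have h1 : `|peval p0 (line origin v t) - g (line origin v t)| <= K * n%:R * A ^+ n.
    rewrite distrC; apply: gp0 => i; rewrite ev tnth_scale normrM.
    apply: le_trans (_ : 1 * `|tnth y i| <= _); last by rewrite mul1r.
    by rewrite ler_wpM2r // normrM (ger0_norm (_ : 0 <= 8)) //; lra.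
  apply: le_trans (ler_distD _ _ _) (le_trans (lerD h1 (g_line horig hv ht)) _).
  by rewrite mulrDr mulr1 mulrA.
have hc k : `|uh`_k| <= N.+1%:R * (16 * N%:R) ^+ N * (K * (n%:R * A ^+ n + 1)).
  have A1 := weight_bound_ge1 dl0 dl1 d0.
  have [kd|dk] := leqP k d.
    rewrite hlow // normr0 mulr_ge0 // ?mulr_ge0 ?exprn_ge0 ?mulr_ge0 //.
    by rewrite addr_ge0 // mulr_ge0 // exprn_ge0 // (le_trans ler01).
  have := coef_le k N0 spsi hpsi.
  by rewrite /psi coefB coefD (nth_default _ (leq_trans sul dk)) (nth_default _ (leq_trans sP dk)) subr0 addr0.
have h8 : `|peval p0 y - peval p y| <=
    N.+1%:R * (N.+1%:R * (16 * N%:R) ^+ N * (K * (n%:R * A ^+ n + 1))).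
  rewrite -eyv huh (horner_coef_wide _ suh).
  apply: (le_trans (ler_norm_sum _ _ _)).
  have cstE (c : R) : N.+1%:R * c = \sum_(k < N.+1) c.
    by rewrite sumr_const card_ord (mulr_natl _ N.+1).
  rewrite cstE.
  apply: ler_sum => k _; apply: le_trans (hc k); rewrite normrM normrX.
  rewrite ler_piMr // exprn_ile1 // ger0_norm //; lra.
apply: le_trans (ler_distD _ _ _) (le_trans (lerD (gp0 _ hy) h8) _).
by rewrite /approx_factor -/N le_eqVlt; apply/orP; left; apply/eqP; ring.
Qed.

End Polynomials.

(** * Choice of the parameters *)

Section Constants.
Context {R : realType}.
Variables (n d : nat).
Hypotheses (n0 : (0 < n)%N) (d0 : (0 < d)%N).

(* [step] is at the same time the spacing of the nodes and the radius on which [g]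
   is defined; it makes the total variation distances below [round_err], which is
   small enough for the union bounds over [O(d)] nodes, used twice. *)
Definition inv_step : nat := 1600 * n * d ^ 3.
Definition step : R := inv_step%:R^-1.
Definition small_dir : R := step / 2.
Definition round_err : R := (400 * d%:R ^+ 2)^-1.
(** The radius [b / 16] of [poly_approx], where [b = small_dir * step] is the size of the directions
    allowed in [corrected_line]. *)
Definition core_radius : R := small_dir * step / 16.

Local Notation W := inv_step.
Local Notation A := (weight_bound d step).

Definition line_err : R := (1 + A) * (3 * A + 2 * A ^+ 2).
(** In units of [alpha]: the threshold [tau = alpha * (1 + A)], plus [tau] times the distance
    between extrapolated values and the final polynomial. *)
Definition total_err : R :=
  (1 + A) * (1 + 2 * A + line_err * approx_factor (n := n) d step).

Lemma inv_step_ge : (1600 <= W)%N /\ (n <= W)%N /\ (d * n < W)%N.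
Proof.
have d3 : (0 < d ^ 3)%N by rewrite expn_gt0 d0.
have dd : (d <= d ^ 3)%N by rewrite -{1}(expn1 d) leq_pexp2l.
rewrite /W; split; first nia.
by split; nia.
Qed.

Lemma inv_step_ge16 : (16 * (d * n) <= W)%N.
Proof.
have dd : (d <= d ^ 3)%N by rewrite -{1}(expn1 d) leq_pexp2l.
rewrite /W; apply: leq_trans (_ : 1600 * (d * n) <= _)%N; first by rewrite leq_mul2r orbT.
by rewrite -mulnA (mulnC n) leq_mul2l leq_mul2r dd !orbT.
Qed.

Lemma step_gt0 : 0 < step.
Proof. by rewrite invr_gt0 ltr0n; have [] := inv_step_ge; lia. Qed.

Lemma step_le : step <= 1 / 2.
Proof.
have [h _] := inv_step_ge.
rewrite /step -[1 / 2]/(1 * 2^-1) mul1r lef_pV2 ?posrE ?ltr0n //; last lia.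
by rewrite ler_nat; lia.
Qed.

Lemma degree_step : d%:R * step <= 1.
Proof.
rewrite ler_pdivrMr ?mul1r ?ler_nat ?ltr0n; have [h [h1 h2]] := inv_step_ge; nia.
Qed.

Lemma perturb_le : perturb (n := n) d step step <= round_err.
Proof.
have n1 : (n%:R : R) != 0 by rewrite pnatr_eq0 -lt0n.
have d1 : (d%:R : R) != 0 by rewrite pnatr_eq0 -lt0n.
have d1' : 1 <= d%:R :> R by rewrite ler1n.
have -> : perturb (n := n) d step step = (2 + d%:R) / (1600 * d%:R ^+ 3).
  by rewrite /perturb /step /W natrM natrX natrM; field; rewrite n1 d1.
have d3 : 0 < d%:R ^+ 3 :> R by rewrite exprn_gt0 // ltr0n.
have c : 0 < 1600 * d%:R ^+ 3 :> R by apply: mulr_gt0 d3; rewrite ltr0n.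
rewrite /round_err ler_pdivrMr; last exact: c.
have -> : (400 * d%:R ^+ 2)^-1 * (1600 * d%:R ^+ 3) = 4 * d%:R :> R by field.
lra.
Qed.

Lemma A_le : A <= W%:R ^+ (3 * d).
Proof.
have [h [h1 h2]] := inv_step_ge.
have W1 : 1600 <= W%:R :> R by rewrite ler_nat.
have -> : (3 * d = d + (2 * d))%N by lia.
rewrite exprD /weight_bound /step invrK; apply: ler_pM => //.
  rewrite -natrX ler_nat; apply: leq_trans (_ : 2 ^ d <= _)%N; first exact: ltn_expl.
  by rewrite leq_exp2r //; lia.
rewrite exprM; apply: lerXn2r; rewrite ?nnegrE ?mulr_ge0 ?exprn_ge0 //.
by rewrite expr2 ler_pM2r //; lra.
Qed.

(** Everything is measured in powers of [X = W ^ (d * n)]. As [X >= 5], a short sum costs one extra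
    power, so the proof only keeps track of exponents. *)
Lemma total_err_le : total_err <= W%:R ^+ (30 * (d * n)).
Proof.
have [hW [hnW hNW]] := inv_step_ge.
set N := (d * n)%N in hNW *.
have N0 : (0 < N)%N by rewrite muln_gt0 d0.
have w1 : 1 <= W%:R :> R by rewrite ler1n; lia.
pose X : R := W%:R ^+ N.
have wX : W%:R <= X by rewrite -[leLHS]expr1 ler_weXn2l.
have X5 : 5 <= X by apply: le_trans wX; rewrite ler_nat; lia.
have X1 : 1 <= X by lra.
have up a b : (a <= b)%N -> X ^+ a <= X ^+ b by move=> ab; rewrite ler_weXn2l.
have X0 a : 0 <= X ^+ a by rewrite exprn_ge0 //; lra.
have add a b c : (a < c)%N -> (b < c)%N -> 5 * X ^+ a <= X ^+ c.
  move=> ac bc; apply: le_trans (up a.+1 c ac); rewrite exprS.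
  by rewrite ler_pM2r // exprn_gt0 //; lra.
have A0 : 1 <= A := weight_bound_ge1 step_gt0 degree_step d0.
have AX : A <= X ^+ 3.
  apply: le_trans A_le _; rewrite /X -exprM ler_weXn2l // mulnC leq_mul2r /=.
  by rewrite leq_pmulr.
have AnX : A ^+ n <= X ^+ 3.
  apply: (@le_trans _ _ ((W%:R ^+ (3 * d)) ^+ n)).
    by apply: lerXn2r; rewrite ?nnegrE ?exprn_ge0 //; [lra|exact: A_le].
  by rewrite /X -!exprM ler_weXn2l // -mulnA mulnC.
have An0 : 0 <= A ^+ n by rewrite exprn_ge0 //; lra.
have nX : n%:R <= X by apply: le_trans wX; rewrite ler_nat.
have NX : N.+1%:R <= X by apply: le_trans wX; rewrite ler_nat.
have NNX : (16 * N%:R) ^+ N <= X.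
  apply: lerXn2r; rewrite ?nnegrE ?mulr_ge0 //.
  by rewrite -natrM ler_nat inv_step_ge16.
have nA : n%:R * A ^+ n <= X ^+ 4 by rewrite exprS ler_pM.
have fac : approx_factor (n := n) d step <= X ^+ 9.
  rewrite /approx_factor -/N.
  have h : N.+1%:R ^+ 2 * (16 * N%:R) ^+ N * (n%:R * A ^+ n + 1) <= X ^+ 8.
    rewrite (_ : 8%N = (2 + 1 + 5)%N) // !exprD expr1.
    apply: ler_pM; rewrite ?mulr_ge0 ?exprn_ge0 ?addr_ge0 ?mulr_ge0 //.
      apply: ler_pM; rewrite ?exprn_ge0 ?mulr_ge0 //.
      by apply: lerXn2r; rewrite ?nnegrE //; lra.
    have := add 4%N 4%N 5%N isT isT; have := up 0%N 4%N isT; rewrite expr0; lra.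
  have := add 8%N 8%N 9%N isT isT; have := up 4%N 8%N isT; have := X0 8%N; lra.
have A2 : A ^+ 2 <= X ^+ 6 by rewrite (_ : 6%N = (3 * 2)%N) // exprM; apply: lerXn2r; rewrite ?nnegrE ?X0 //; lra.
have A20 : 0 <= A ^+ 2 by rewrite exprn_ge0 //; lra.
have A1X : 1 + A <= X ^+ 4.
  have := add 3%N 3%N 4%N isT isT; have := up 0%N 3%N isT; rewrite expr0; lra.
have lin : line_err <= X ^+ 11.
  rewrite /line_err (_ : 11%N = (4 + 7)%N) // exprD; apply: ler_pM; [lra|lra|exact: A1X|].
  have := add 6%N 6%N 7%N isT isT; have := up 3%N 6%N isT; lra.
have lin0 : 0 <= line_err by rewrite /line_err mulr_ge0 //; lra.
have fac0 : 0 <= approx_factor (n := n) d step.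
  have nA0 : 0 <= n%:R * A ^+ n by rewrite mulr_ge0.
  have q1 : 0 <= (N.+1%:R : R) ^+ 2 by exact: exprn_ge0.
  have q2 : 0 <= (16 * N%:R : R) ^+ N by apply: exprn_ge0; rewrite mulr_ge0.
  have q3 : 0 <= n%:R * A ^+ n + 1 by exact: addr_ge0.
  exact: addr_ge0 nA0 (mulr_ge0 (mulr_ge0 q1 q2) q3).
have lf : line_err * approx_factor (n := n) d step <= X ^+ 20.
  by rewrite (_ : 20%N = (11 + 9)%N) // exprD; apply: ler_pM.
have lf0 : 0 <= line_err * approx_factor (n := n) d step by rewrite mulr_ge0.
apply: (@le_trans _ _ (X ^+ 25)); last first.
  by rewrite /X -exprM ler_weXn2l // mulnC leq_mul2r orbT.
rewrite /total_err (_ : 25%N = (4 + 21)%N) // exprD; apply: ler_pM; [lra|lra|exact: A1X|].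
have := add 20%N 20%N 21%N isT isT; have := up 0%N 20%N isT; have := up 3%N 20%N isT.
rewrite expr0; lra.
Qed.

(** Origin of the constant 12. With [W <= 2 ^ (11 + n + 3 * d)] and both [n] and [d] at most
    [Z = (2 * n) ^ d], the exponent is at most [16 Z * 32 * Z * Z], where [16 <= Z ^ 4] and
    [32 <= Z ^ 5]. *)
Lemma W_exp_le : (W ^ (30 * (d * n)) <= 2 ^ ((2 * n) ^ (12 * d)))%N.
Proof.
have n2 k : (0 < (2 * n) ^ k)%N by rewrite expn_gt0 muln_gt0 n0.
have d2n : (d <= (2 * n) ^ d)%N.
  apply: leq_trans (_ : 2 ^ d <= _)%N; first exact: ltnW (ltn_expl _ _).
  by rewrite leq_exp2r //; lia.
have n2n : (n <= (2 * n) ^ d)%N.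
  apply: leq_trans (_ : (2 * n) ^ 1 <= _)%N; first by rewrite expn1; lia.
  by rewrite leq_pexp2l //; lia.
have c4 : (16 <= (2 * n) ^ (4 * d))%N.
  apply: leq_trans (_ : 2 ^ (4 * d) <= _)%N; last by rewrite leq_exp2r //; lia.
  by rewrite expnM -[X in (X <= _)%N]/((2 ^ 4) ^ 1)%N leq_pexp2l.
have c5 : (32 <= (2 * n) ^ (5 * d))%N.
  apply: leq_trans (_ : 2 ^ (5 * d) <= _)%N; last by rewrite leq_exp2r //; lia.
  by rewrite expnM -[X in (X <= _)%N]/((2 ^ 5) ^ 1)%N leq_pexp2l.
have W2 : (W <= 2 ^ (11 + n + 3 * d))%N.
  rewrite /W 2!expnD (mulnC 3%N) expnM; apply: leq_mul.
    by apply: leq_mul => //; exact: ltnW (ltn_expl _ _).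
  by rewrite leq_exp2r //; exact: ltnW (ltn_expl _ _).
apply: leq_trans (_ : (2 ^ (11 + n + 3 * d)) ^ (30 * (d * n)) <= _)%N.
  by rewrite leq_exp2r // muln_gt0 /= muln_gt0 d0.
rewrite -expnM leq_pexp2l //.
have -> : ((2 * n) ^ (12 * d) = (2 * n) ^ (4 * d) * (2 * n) ^ d *
   ((2 * n) ^ (5 * d) * ((2 * n) ^ d * (2 * n) ^ d)))%N.
  by rewrite -!expnD; congr (_ ^ _)%N; lia.
apply: leq_mul; last by apply: leq_mul; [lia | apply: leq_mul].
apply: leq_trans (_ : 16 * (2 * n) ^ d <= _)%N; last by rewrite leq_mul2r c4 orbT.
have := n2 d; lia.
Qed.

End Constants.

(** * Rare rejection by a round yields a polynomial *)

Section Soundness.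
Context {R : realType}.
Variables (n d : nat).
Hypotheses (n0 : (0 < n)%N) (d0 : (0 < d)%N).
Local Notation step := (@step R n d).
Local Notation A := (@weight_bound R d step).
Local Notation U := (@cube R n).
Local Notation rho := (@small_dir R n d).
Local Notation eta := (@round_err R d).
Local Notation fac := (@approx_factor R n d step).

Lemma corrected_poly (F : Rn R n -> R) (tau : R) :
  measurable_fun setT F -> 0 < tau ->
  ((U \x U) [set w | (tau < `|resid d step F 0 w.1 w.2|)%R] <= eta%:E)%E ->
  ((U \x U) [set w | (tau < `|resid d step F 0 w.1 (scale rho w.2)|)%R] <= eta%:E)%E ->
  ((U \x U \x unif01) [set w | (`|w.2| <= 2)%R /\
     (tau < `|resid d step F w.2 w.1.1 (scale rho w.1.2)|)%R] <= eta%:E)%E ->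
  exists2 p : mpoly n R, (msize p <= d.+1)%N &
    forall y, small (core_radius n d) y ->
      (U [set q | (tau * (2 * A + line_err n d * fac) <
           `|interp d step F 0 y q - peval p y|)%R] <= (1 / 40)%:E)%E.
Proof.
move=> mF tau0 t1 t2 t3.
have s0 := @step_gt0 R n d n0 d0.
have sd := @degree_step R n d n0 d0.
have s12 := @step_le R n d n0 d0.
have kp := @perturb_le R n d n0 d0.
have k0 : 0 <= perturb (n := n) d step step by exact: perturb_ge0.
have d1 : 1 <= d%:R :> R by rewrite ler1n.
set D : R := d%:R in d1.
have D1 : d.+1%:R <= 2 * D :> R by rewrite -natr1 /D; lra.
have D2 : d.+2%:R <= 3 * D :> R by rewrite -natr1 -natr1 /D; lra.
pose iD := D^-1.
have iD0 : 0 < iD by rewrite invr_gt0; lra.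
have iD1 : D * iD = 1 by rewrite mulfV // gt_eqF; lra.
have iDle : iD <= 1 by rewrite invf_le1; lra.
have etaE : eta = iD ^+ 2 / 400.
  by rewrite /round_err -/D /iD invfM exprVn mulrC.
have eta0 : 0 <= eta by rewrite etaE mulr_ge0 ?invr_ge0 ?ler0n // exprn_ge0 // ltW.
have DD : D * iD ^+ 2 = iD by rewrite expr2 mulrA iD1 mul1r.
(* [xi] and [eta'] are of order [1 / d]: large enough to dominate [O(d)] errors of order
   [1 / d ^ 2], small enough for [O(d)] of them to total less than 1. *)
pose xi := iD / 40.
pose eta' := iD / 8.
have ge0n (k : nat) : 0 <= k%:R :> R by [].
have hxi : 2 * d.+1%:R * (eta + perturb (n := n) d step step) < xi.
  apply: (@le_lt_trans _ _ (2 * (2 * D) * (2 * eta))).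
    apply: ler_pM; rewrite ?mulr_ge0 ?addr_ge0 //.
      by rewrite ler_pM2l.
    lra.
  have -> : 2 * (2 * D) * (2 * eta) = iD / 50.
    by rewrite etaE -[in RHS]DD; field.
  rewrite /xi; lra.
have hlt : d.+2%:R * (xi + perturb (n := n) d step step) +
    d.+1%:R * (eta' + 2 * perturb (n := n) d step step) < 1.
  apply: (@le_lt_trans _ _ (3 * D * (xi + eta) + 2 * D * (eta' + 2 * eta))).
    have x0 : 0 <= xi by rewrite /xi; lra.
    have e0 : 0 <= eta' by rewrite /eta'; lra.
    apply: lerD; apply: ler_pM => //; try lra.
  have -> : 3 * D * (xi + eta) + 2 * D * (eta' + 2 * eta) =
      13 / 40 * (D * iD) + 7 / 400 * (D * iD ^+ 2).
    by rewrite etaE /xi /eta'; field.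
  rewrite iD1 DD; lra.
have heta : 4 * d.+1%:R * eta < eta'.
  apply: (@le_lt_trans _ _ (4 * (2 * D) * eta)).
    by rewrite ler_wpM2r // ler_pM2l.
  have -> : 4 * (2 * D) * eta = iD / 50 by rewrite etaE -[in RHS]DD; field.
  rewrite /eta'; lra.
have heta' : eta <= eta'.
  have d11 : 1 <= d.+1%:R :> R by rewrite ler1n.
  apply: le_trans (ltW heta); apply: ler_peMl eta0 _; lra.
(* Away from the origin the value of [g] is arbitrary (0 here), which makes [g] a total function. *)
have hex y : exists c, small step y ->
    (U [set q | (2 * A * tau < `|interp d step F 0 y q - c|)%R] <= xi%:E)%E.
  have [hy|hy] := pselect (small step y); last by exists 0.
  by have [c hc] := corrected_exists mF s0 sd s0 t1 hxi hy; exists c.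
have /choice[g hg] := hex.
have rho0 : 0 < rho by rewrite divr_gt0.
have rhoY : 2 * rho <= step by rewrite /small_dir mulrC divfK.
pose b := rho * step.
have b0 : 0 < b by rewrite mulr_gt0.
have b2 : b <= step / 2.
  have s1 : step <= 1 by rewrite (le_trans s12) // ler_pdivrMr // mul1r ler1n.
  by apply: ler_piMr s1; rewrite divr_ge0 // ltW.
pose K := line_err n d * tau.
have A1 : 1 <= A := weight_bound_ge1 s0 sd d0.
have A0 : 0 <= A := le_trans ler01 A1.
have l0 : 0 <= line_err n d :> R.
  by rewrite /line_err mulr_ge0 // addr_ge0 // mulr_ge0 // exprn_ge0.
have K0 : 0 <= K by rewrite mulr_ge0 // ltW.
have gline y v t : small b y -> small b v -> `|t| <= 1 / 8 ->
    `|g (line y v t) - \sum_(i < d.+1) weight step t i * g (line y v (node step i))| <= K.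
  move=> hy hv ht; rewrite /K /line_err -mulrA.
  apply: (@corrected_line R n d step F mF s0 sd d0 tau eta xi step tau0 s0 g rho
    hg rho0 rhoY eta') => //.
  - rewrite /eta'; lra.
  - by apply: le_trans t2 _; rewrite lee_fin.
  - by move=> i; apply: le_trans (hy i) _.
have [p sp hp] := poly_approx d0 s0 sd b0 K0 gline n0.
exists p => // y hy.
have {}hp := hp y hy.
have hys : small step y.
  by move=> i; apply: le_trans (hy i) _; rewrite /core_radius -/b; lra.
apply: (@le_trans _ _ xi%:E); last first.
  rewrite lee_fin /xi; lra.
apply: le_trans (hg y hys); apply: le_measure; rewrite ?inE.
- apply: measurable_norm_gt; apply: measurable_funB => //.
  exact: measurable_interp.
- apply: measurable_norm_gt; apply: measurable_funB => //.
  exact: measurable_interp.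
move=> q /=; apply: contraTT; rewrite -!leNgt => h.
apply: le_trans (ler_distD (g y) _ _) (le_trans (lerD h hp) _).
rewrite /K le_eqVlt; apply/orP; left; apply/eqP; ring.
Qed.

End Soundness.

(** * The tester *)

(** [(1 - x) ^ k * (1 + k x)] does not increase with [k]. The bound is a rational substitute for
    [exp (- k x)]. *)
Lemma expr_1B_le (R : realFieldType) (x : R) k : 0 <= x <= 1 ->
  (1 - x) ^+ k <= (1 + k%:R * x)^-1.
Proof.
move=> /andP[x0 x1].
have kx j : 0 <= j%:R * x by rewrite mulr_ge0.
suff h : (1 - x) ^+ k * (1 + k%:R * x) <= 1.
  by rewrite -[leRHS]mul1r ler_pdivlMr // ltr_pwDl.
elim: k => [|k IH]; first by rewrite mul0r addr0 mulr1.
apply: le_trans IH; rewrite exprSr -mulrA; apply: ler_wpM2l.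
  by rewrite exprn_ge0 // subr_ge0.
rewrite -natr1; have := kx k; have : 0 <= k%:R * x * x by rewrite mulr_ge0.
nra.
Qed.

Section Ask.
Variables (X : eqType) (Y : Type).

(* A non-adaptive algorithm can be given by a predicate [D] of the whole function,
   as long as [D] only depends on the values at the points of [s]. *)
Fixpoint ask (s : seq X) (tbl : X -> Y) (D : (X -> Y) -> bool) : query_tree X Y :=
  match s with
  | [::] => Output X Y (D tbl)
  | x :: s' => Query x (fun y => ask s' (fun z => if z == x then y else tbl z) D)
  end.

Lemma run_ask f s tbl D :
  run f (ask s tbl D) = D (fun z => if z \in s then f z else tbl z).
Proof.
elim: s tbl => [|x s IH] tbl //=; rewrite IH; congr D; apply/funext => z.
by rewrite in_cons; case: (eqVneq z x) => [->|_] //=; case: ifP.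
Qed.

Lemma num_queries_ask f s tbl D : num_queries f (ask s tbl D) = size s.
Proof. by elim: s tbl => [|x s IH] tbl //=; rewrite IH. Qed.

End Ask.

Lemma size_flatten_const (T : Type) (I : finType) (F : I -> seq T) c :
  (forall i, size (F i) = c) -> size (flatten [seq F i | i <- enum I]) = (#|I| * c)%N.
Proof.
move=> h; rewrite size_flatten /shape -map_comp.
rewrite (eq_map (g := fun=> c)); last by move=> i /=; rewrite h.
by rewrite cardE; elim: (enum I) => //= _ s ->; rewrite mulSn.
Qed.

Section Degree.
Context {R : realType} {n : nat}.

Lemma poly_degree_le_scale (d : nat) (h : Rn R n -> R) (c : R) :
  poly_degree_le d h -> poly_degree_le d (fun x => h (scale c x)).
Proof.
move=> [p [sp hp]].
exists (\sum_(m <- msupp p) (mcoeff m p * c ^+ mdeg m) *: mpolyX R m); split.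
  rewrite big_seq; apply: msize_sum_le => m hm; apply: leq_trans (msizeZ_le _ _) _.
  by rewrite msizeX; apply: leq_trans sp; exact: msize_mdeg_lt.
move=> x; rewrite hp mevalE raddf_sum /=; apply: eq_bigr => m _.
rewrite mevalZ mevalX -mulrA; congr (_ * _).
rewrite mdegE expr_sum -big_split /=; apply: eq_bigr => i _.
by rewrite tnth_scale exprMn.
Qed.

Lemma measurable_poly (d : nat) (h : Rn R n -> R) :
  poly_degree_le d h -> measurable_fun setT h.
Proof.
move=> [p [_ hp]]; rewrite (_ : h = fun x => meval (fun i => tnth x i : R) p).
  under eq_fun do rewrite mevalE.
  apply: measurable_sum => m; apply: measurable_funM => //.
  apply: measurable_prod => i _; apply: measurable_funX.
  exact: (measurable_tnth i).
exact/funext.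
Qed.

Lemma measurable_eball (r : R) : measurable (eball (origin : Rn R n) r).
Proof.
rewrite -[X in measurable X]setTI.
have mf : measurable_fun setT (fun x : Rn R n => Defs.edist origin x).
  rewrite /Defs.edist; apply: (measurableT_comp (continuous_measurable_fun (@sqrt_continuous R))).
  apply: measurable_sum => i; apply: measurable_funX; apply: measurable_funB => //.
  exact: (measurable_tnth i).
have -> : eball (origin : Rn R n) r = (fun x => Defs.edist origin x) @^-1` `]-oo, r[%classic.
  by apply/seteqP; split => x /=; rewrite /eball /= in_itv.
exact: mf.
Qed.

Lemma tnth_le_edist (x : Rn R n) i : `|tnth x i| <= Defs.edist origin x.
Proof.
rewrite -sqrtr_sqr /Defs.edist ler_wsqrtr // (bigD1 i) //= tnth_mktuple sub0r sqrrN.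
by rewrite lerDl sumr_ge0 // => j _; exact: sqr_ge0.
Qed.

End Degree.

Section Tester.
Context {R : realType}.
Variables (n d : nat).
Variables (M tau : R).

Local Notation step := (@step R n d).
Local Notation rho := (@small_dir R n d).
Local Notation eta := (@round_err R d).
Local Notation A := (@weight_bound R d step).
Local Notation U := (@cube R n).
Local Notation round := ((Rn R n * Rn R n) * measurableTypeR R)%type.

Definition rescale (f : Rn R n -> R) : Rn R n -> R := fun x => f (scale M x).

Definition round_law : probability round R := (U \x U \x unif01)%E.

(* [`|w.2| <= 2] holds almost surely; including it makes the tester accept a function
   close to a polynomial for every value of the seed. *)
Definition reject_round (F : Rn R n -> R) (w : round) : bool :=
  [|| tau < `|resid d step F 0 w.1.1 w.1.2|,
      tau < `|resid d step F 0 w.1.1 (scale rho w.1.2)| |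
      (`|w.2| <= 2) && (tau < `|resid d step F w.2 w.1.1 (scale rho w.1.2)|)].

Definition reject_sample (F : Rn R n -> R) (q p : Rn R n) : bool :=
  tau < `|resid d step F 0 (scale M^-1 p) q|.

Variables (k1 k2 : nat).
Local Notation seedT := (k1.-tuple round * Rn R n)%type.

Definition accepts (w : seedT) (ps : k2.-tuple (Rn R n)) (f : Rn R n -> R) : bool :=
  [forall i, ~~ reject_round (rescale f) (tnth w.1 i)] &&
  [forall i, ~~ reject_sample (rescale f) w.2 (tnth ps i)].

Definition resid_points (t : R) (x q : Rn R n) : seq (Rn R n) :=
  scale M (line x q t) :: [seq scale M (line x q (node step i)) | i : 'I_d.+1 <- enum 'I_d.+1].

Definition round_points (w : round) : seq (Rn R n) :=
  resid_points 0 w.1.1 w.1.2 ++ resid_points 0 w.1.1 (scale rho w.1.2) ++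
  resid_points w.2 w.1.1 (scale rho w.1.2).

Definition query_points (w : seedT) (ps : k2.-tuple (Rn R n)) : seq (Rn R n) :=
  flatten [seq round_points (tnth w.1 i) | i <- enum 'I_k1] ++
  flatten [seq resid_points 0 (scale M^-1 (tnth ps i)) w.2 | i <- enum 'I_k2].

Lemma size_query_points w ps :
  size (query_points w ps) = (k1 * (3 * d.+2) + k2 * d.+2)%N.
Proof.
have h t x q : size (resid_points t x q) = d.+2 by rewrite /= size_map size_enum_ord.
rewrite size_cat (@size_flatten_const _ _ _ (3 * d.+2)); last first.
  by move=> i; rewrite !size_cat !h; lia.
by rewrite (@size_flatten_const _ _ _ d.+2) // !card_ord.
Qed.

Lemma resid_rescale_eq f f' t x q :
  {in resid_points t x q, f =1 f'} ->
  resid d step (rescale f) t x q = resid d step (rescale f') t x q.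
Proof.
move=> h; rewrite /resid /rescale h ?mem_head //; congr (_ - _).
apply: eq_bigr => i _; congr (_ * _); apply: h.
by rewrite in_cons; apply/orP; right; apply/mapP; exists i; rewrite ?mem_enum.
Qed.

Lemma accepts_eq w ps f f' : {in query_points w ps, f =1 f'} ->
  accepts w ps f = accepts w ps f'.
Proof.
move=> h; congr (_ && _); apply: eq_forallb => i; congr (~~ _).
  have hr : {in round_points (tnth w.1 i), f =1 f'}.
    move=> z hz; apply: h; rewrite mem_cat; apply/orP; left.
    apply/flattenP; exists (round_points (tnth w.1 i)) => //.
    by apply/mapP; exists i; rewrite ?mem_enum.
  rewrite /reject_round.
  rewrite (@resid_rescale_eq f f' 0 (tnth w.1 i).1.1 (tnth w.1 i).1.2); last first.
    by move=> z hz; apply: hr; rewrite !mem_cat hz.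
  rewrite (@resid_rescale_eq f f' 0 (tnth w.1 i).1.1 (scale rho (tnth w.1 i).1.2)); last first.
    by move=> z hz; apply: hr; rewrite !mem_cat hz orbT.
  rewrite (@resid_rescale_eq f f' (tnth w.1 i).2) //.
  by move=> z hz; apply: hr; rewrite !mem_cat hz !orbT.
rewrite /reject_sample (@resid_rescale_eq f f') // => z hz.
apply: h; rewrite mem_cat; apply/orP; right; apply/flattenP.
exists (resid_points 0 (scale M^-1 (tnth ps i)) w.2) => //.
by apply/mapP; exists i; rewrite ?mem_enum.
Qed.

Definition low_degree_tester : tester R n :=
  @Tester R n _ _ (iid round_law k1 \x U)%E k2
    (fun w ps => ask (query_points w ps) (fun=> 0) (accepts w ps)).

Lemma run_low_degree_tester f w ps :
  run f (strategy (t := low_degree_tester) w ps) = accepts w ps f.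
Proof. by rewrite run_ask; apply: accepts_eq => z ->. Qed.

Lemma num_queries_low_degree_tester f w ps :
  num_queries f (strategy (t := low_degree_tester) w ps) =
  (k1 * (3 * d.+2) + k2 * d.+2)%N.
Proof. by rewrite num_queries_ask size_query_points. Qed.

Section Completeness.
Hypotheses (n0 : (0 < n)%N) (d0 : (0 < d)%N).
Variables (alpha : R).
Hypothesis tauE : tau = alpha * (1 + A).

(** Interpolation reproduces [h] exactly on a line, so only the error [alpha] at [t] and the
    weighted errors at the nodes remain. This dictates [tau = alpha * (1 + A)]. *)
Lemma resid_close (F h : Rn R n -> R) t x q :
  poly_degree_le d h -> pointwise_close alpha F h -> `|t| <= 2 ->
  `|resid d step F t x q| <= tau.
Proof.
move=> [p [sp hp]] hF t2.
have [u su hu] := poly_on_line x q sp.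
have hE s : h (line x q s) = u.[s] by rewrite hp -hu.
have s0 := @step_gt0 R n d n0 d0.
have hi : h (line x q t) = \sum_(i < d.+1) weight step t i * h (line x q (node step i)).
  by rewrite hE -(weight_poly s0 t su); apply: eq_bigr => i _; rewrite hE.
have e1 : `|F (line x q t) - h (line x q t)| <= alpha by exact: ltW.
have e2 (i : 'I_d.+1) : `|h (line x q (node step i)) - F (line x q (node step i))| <= alpha.
  by rewrite distrC; exact: ltW.
have e3 := weight_sum_close s0 (@degree_step R n d n0 d0) t2 e2.
rewrite -hi in e3; rewrite tauE mulrDr mulr1 (mulrC alpha A).
exact: le_trans (ler_distD (h (line x q t)) _ _) (lerD e1 e3).
Qed.

Lemma completeness f h w ps :
  poly_degree_le d h -> pointwise_close alpha f h -> accepts w ps f.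
Proof.
move=> hh hf.
have hF : pointwise_close alpha (rescale f) (fun x => h (scale M x)).
  by move=> x; exact: hf.
have hH := poly_degree_le_scale M hh.
have n02 : `|0 : R| <= 2 by rewrite normr0.
apply/andP; split; apply/forallP => i.
  have r t x q : `|t| <= 2 -> `|resid d step (rescale f) t x q| <= tau.
    exact: resid_close hH hF.
  by apply/negP => /or3P[|| /andP[t2]]; rewrite ltNge => /negP; apply; exact: r.
by rewrite -leNgt; exact: (resid_close _ _ hH hF n02).
Qed.

End Completeness.

Lemma measurable_rescale f : measurable_fun setT f -> measurable_fun setT (rescale f).
Proof.
by move=> mf; apply: (measurableT_comp mf); apply: measurable_line.
Qed.

Lemma measurable_reject_round F : measurable_fun setT F ->
  measurable [set w | reject_round F w].
Proof.
move=> mF.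
pose E1 := [set w : round | tau < `|resid d step F 0 w.1.1 w.1.2|].
pose E2 := [set w : round | tau < `|resid d step F 0 w.1.1 (scale rho w.1.2)|].
pose E3 := [set w : round | `|w.2| <= 2 /\
  tau < `|resid d step F w.2 w.1.1 (scale rho w.1.2)|].
have mx : measurable_fun setT (fun w : round => w.1.1) by exact: (measurableT_comp measurable_fst).
have mq : measurable_fun setT (fun w : round => w.1.2) by exact: (measurableT_comp measurable_snd).
have -> : [set w | reject_round F w] = E1 `|` (E2 `|` E3).
  apply/seteqP; split => w; rewrite /reject_round /=.
    by move=> /or3P[h|h|/andP[h1 h2]]; [left|right; left|right; right].
  by move=> [h|[h|[h1 h2]]]; apply/or3P;
    [apply: Or31|apply: Or32|apply: Or33; apply/andP].
apply: measurableU; last apply: measurableU; last exact: measurable_scaled_test.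
  by apply: measurable_norm_gt; apply: measurable_resid.
by apply: measurable_norm_gt; apply: measurable_resid => //; apply: measurable_line.
Qed.

Lemma round_reject_le F (e : R) : measurable_fun setT F ->
  (round_law [set w | reject_round F w] <= e%:E)%E ->
  [/\ ((U \x U) [set w | (tau < `|resid d step F 0 w.1 w.2|)%R] <= e%:E)%E,
      ((U \x U) [set w | (tau < `|resid d step F 0 w.1 (scale rho w.2)|)%R] <= e%:E)%E &
      ((U \x U \x unif01) [set w | (`|w.2| <= 2)%R /\
        (tau < `|resid d step F w.2 w.1.1 (scale rho w.1.2)|)%R] <= e%:E)%E].
Proof.
move=> mF he.
have mr := measurable_reject_round mF.
have mono (B : set round) : measurable B -> B `<=` [set w | reject_round F w] ->
    (round_law B <= e%:E)%E.
  by move=> mB hB; apply: le_trans he; apply: le_measure; rewrite ?inE.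
have mono_fst (B : set (Rn R n * Rn R n)) : measurable B ->
    B `*` [set: measurableTypeR R] `<=` [set w | reject_round F w] ->
    ((U \x U)%E B <= e%:E)%E.
  move=> mB hB; pose UU : probability (Rn R n * Rn R n)%type R := (U \x U)%E.
  have := product_measure1E UU unif01 mB measurableT.
  rewrite [X in (_ * X)%E]probability_setT mule1 => <-.
  by apply: mono => //; exact: measurableX.
split.
- apply: mono_fst; first by apply: measurable_norm_gt; apply: measurable_resid.
  by move=> w [/= h _]; rewrite /reject_round h.
- apply: mono_fst.
    by apply: measurable_norm_gt; apply: measurable_resid => //; apply: measurable_line.
  by move=> w [/= h _]; rewrite /reject_round h orbT.
apply: mono; first exact: measurable_scaled_test.
by move=> w [/= h1 h2]; rewrite /reject_round h1 h2 !orbT.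
Qed.

End Tester.

(** * Rejection in the far case *)

Lemma iid_exists_ge {R : realType} d (T : measurableType d) (D : probability T R)
    (B : set T) (x : R) k : measurable B -> 0 <= x <= 1 -> (x%:E <= D B)%E ->
  measurable [set s : k.-tuple T | exists i, B (tnth s i)] /\
  ((1 - (1 + k%:R * x)^-1)%:E <= iid D k [set s | exists i, B (tnth s i)])%E.
Proof.
move=> mB x01 hx.
have mN : measurable [set s : k.-tuple T | forall i, (~` B) (tnth s i)].
  exact: (@measurable_tnth_forall _ T k (fun=> ~` B) (fun=> measurableC mB)).
have e : [set s : k.-tuple T | exists i, B (tnth s i)] =
    ~` [set s | forall i, (~` B) (tnth s i)].
  by apply/seteqP; split=> s /=; [move=> [i hi] /(_ i)|move=> /existsNP[i /contrapT]; exists i].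
split; first by rewrite e; exact: measurableC.
have h := iid_rect D (A := fun=> ~` B) (fun _ : 'I_k => measurableC mB).
have hC : (iid D k [set s | forall i, (~` B) (tnth s i)] <= ((1 - x) ^+ k)%:E)%E.
  rewrite h; have hN : (D (~` B) <= (1 - x)%:E)%E.
    by rewrite probability_setC // EFinB; exact: leeB.
  elim: k {mN e h} => [|k IH]; first by rewrite big_ord0 expr0.
  rewrite big_ord_recr exprSr EFinM /=; apply: lee_pmul => //.
  by apply: prode_ge0.
rewrite e probability_setC // EFinB; apply: leeB => //.
by apply: le_trans hC _; rewrite lee_fin expr_1B_le.
Qed.

Section Rejection.
Context {R : realType}.
Variables (n d : nat).
Variables (M tau : R) (k1 k2 : nat).
Hypothesis M0 : 0 < M.
Variables (f : Rn R n -> R) (D : probability (Rn R n) R).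
Hypothesis mf : measurable_fun setT f.

Local Notation step := (@step R n d).
Local Notation eta := (@round_err R d).
Local Notation A := (@weight_bound R d step).
Local Notation U := (@cube R n).
Local Notation T := (@low_degree_tester R n d M tau k1 k2).
Local Notation F := (rescale M f).
Local Notation rej := [set w | @reject_round R n d tau F w].

Lemma reject_by_rounds : 2 <= k1%:R * eta ->
  (eta%:E <= round_law n [set w | @reject_round R n d tau F w])%E ->
  has_prob_ge (run_law T D) (outcome_event T f false) (2 / 3).
Proof.
move=> hk he.
have mF := measurable_rescale M mf.
have mr := @measurable_reject_round R n d tau _ mF.
have eta01 : 0 <= eta <= 1.
  apply/andP; split; first by rewrite invr_ge0 mulr_ge0 ?ler0n ?exprn_ge0.
  by rewrite -lee_fin; apply: le_trans he _; exact: probability_le1.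
have [mG PG] := iid_exists_ge k1 mr eta01 he.
set G := [set s | _] in mG PG.
exists (G `*` [set: Rn R n] `*` [set: k2.-tuple (Rn R n)]); split.
- by apply: measurableX => //; exact: measurableX.
- move=> [[w q] ps] [[[i hi] _] _]; rewrite /outcome_event /= run_low_degree_tester.
  rewrite /accepts; apply/negbTE; rewrite negb_and; apply/orP; left.
  by rewrite negb_forall; apply/existsP; exists i; rewrite negbK.
pose S : probability (k1.-tuple _ * Rn R n)%type R := (iid (round_law n) k1 \x U)%E.
have mGT : measurable (G `*` [set: Rn R n]) by exact: measurableX.
have := product_measure1E S (iid D k2) mGT measurableT.
have := product_measure1E (iid (round_law n) k1) U mG measurableT.
rewrite [X in (_ * X)%E]probability_setT mule1 => e1.
rewrite [X in (_ * X)%E]probability_setT mule1 => e2.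
apply: (@le_trans _ _ (iid (round_law n) k1 G)); last first.
  by rewrite -e1 -e2.
apply: le_trans PG; rewrite lee_fin.
have : (1 + k1%:R * eta)^-1 <= 3^-1 by rewrite lef_pV2 ?posrE; lra.
lra.
Qed.

(* With probability 9/10 some sample is bad; a single direction [q], shared by all
   samples, then reveals it with probability 39/40. *)
Lemma reject_by_samples (p : mpoly n R) (eps r beta E : R) :
  (msize p <= d.+1)%N -> 0 < eps < 1 -> r <= M * core_radius n d ->
  tau + E <= beta -> 9 <= k2%:R * (3 * eps / 4) ->
  (forall y, small (core_radius n d) y ->
    (U [set q | (E < `|interp d step F 0 y q - peval p y|)%R] <= (1 / 40)%:E)%E) ->
  concentrated (eps / 4) r D ->
  (eps%:E < D [set x | (beta < `|f x - peval p (scale M^-1 x)|)%R])%E ->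
  has_prob_ge (run_law T D) (outcome_event T f false) (2 / 3).
Proof.
move=> sp /andP[eps0 eps1] hr hb hk hp hD hbad.
have mF := measurable_rescale M mf.
have mp : measurable_fun setT (fun x : Rn R n => peval p (scale M^-1 x)).
  apply: (@measurable_poly _ _ d).
  by apply: (poly_degree_le_scale M^-1); exists p; split.
pose bad := [set x | beta < `|f x - peval p (scale M^-1 x)|].
have mbad : measurable bad by apply: measurable_norm_gt; exact: measurable_funB.
have mball := @measurable_eball R n r.
pose B := bad `&` eball origin r.
have mB : measurable B by exact: measurableI.
(* Concentration removes at most [eps / 4] of the mass of [bad]. *)
have hB : ((3 * eps / 4)%:E <= D B)%E.
  have h1 : (D (~` eball origin r) <= (eps / 4)%:E)%E.
    rewrite probability_setC //; move: hD; rewrite /concentrated.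
    rewrite -[D (eball _ _)]fineK; last exact: fin_num_measure.
    by rewrite -EFinB !lee_fin; lra.
  have h2 : (D bad <= D B + D (~` eball origin r))%E.
    apply: le_trans (measureU2 _ mB (measurableC mball)).
    apply: le_measure; rewrite ?inE //; first exact: measurableU _ _ mB (measurableC mball).
    by move=> x hx; case: (pselect (eball origin r x)) => h; [left|right].
  have := lt_le_trans hbad (le_trans h2 (leeD2l (D B) h1)).
  rewrite -[D B]fineK; last exact: fin_num_measure.
  by rewrite -EFinD lte_fin lee_fin; lra.
have x01 : 0 <= 3 * eps / 4 <= 1 by apply/andP; split; lra.
have [mG PG] := iid_exists_ge k2 mB x01 hB.
set G := [set s | _] in mG PG.
pose S : probability (k1.-tuple _ * Rn R n)%type R := (iid (round_law n) k1 \x U)%E.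
pose Ei (i : 'I_k2) := [set w : (k1.-tuple ((Rn R n * Rn R n) * measurableTypeR R) * Rn R n) *
   k2.-tuple (Rn R n) | B (tnth w.2 i) /\ @reject_sample R n d M tau F w.1.2 (tnth w.2 i)].
have mt i : measurable_fun setT (fun w : (k1.-tuple ((Rn R n * Rn R n) * measurableTypeR R) * Rn R n) *
   k2.-tuple (Rn R n) => tnth w.2 i).
  exact: (measurableT_comp (measurable_tnth i) measurable_snd).
have mEi i : measurable (Ei i).
  apply: measurableI.
    by rewrite -[X in measurable X]setTI; exact: mt.
  apply: measurable_norm_gt; apply: measurable_resid => //.
    by apply: measurable_line => //; exact: mt.
  exact: (measurableT_comp measurable_snd).
have [mE _] := union_bound (S \x iid D k2)%E mEi.
exists [set w | exists i, Ei i w]; split => //.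
  move=> [[w q] ps] [i [_ /= hi]]; rewrite /outcome_event /= run_low_degree_tester.
  rewrite /accepts; apply/negbTE; rewrite negb_and; apply/orP; right.
  by rewrite negb_forall; apply/existsP; exists i; rewrite negbK.
have c0 : 0 <= 39 / 40 :> R by lra.
have key ps : G ps -> ((39 / 40)%:E <= S (ysection [set w | exists i, Ei i w] ps))%E.
  move=> [i hi]; pose x := tnth ps i; pose y := scale M^-1 x.
  have hy : small (core_radius n d) y.
    move=> l; rewrite tnth_scale normrM normfV (gtr0_norm M0) ler_pdivrMl //.
    by apply: le_trans (tnth_le_edist x l) (le_trans (ltW hi.2) hr).
  have Fy : F y = f x.
    rewrite /rescale; congr f; apply: eq_from_tnth => l.
    by rewrite !tnth_scale mulVKf // gt_eqF.
  pose C := [set q | E < `|interp d step F 0 y q - peval p y|].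
  have mC : measurable C.
    by apply: measurable_norm_gt; apply: measurable_funB => //; exact: measurable_interp.
  have mQ : measurable [set q | @reject_sample R n d M tau F q x].
    by apply: measurable_norm_gt; exact: measurable_resid.
  have hQ : ((39 / 40)%:E <= U [set q | @reject_sample R n d M tau F q x])%E.
    apply: (@le_trans _ _ (U (~` C))).
      rewrite probability_setC // (_ : (39 / 40)%:E = (1 - (1 / 40)%:E)%E); last first.
        by rewrite -EFinB; congr (_%:E); field.
      by apply: leeB => //; exact: hp.
    apply: le_measure; rewrite ?inE //; first exact: measurableC.
    move=> q /= /negP; rewrite -leNgt => hq.
    rewrite /reject_sample /resid line0 -/y Fy.
    have h1 : beta < `|f x - peval p y| := hi.1.
    have := ler_distD (interp d step F 0 y q) (f x) (peval p y); lra.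
  apply: (@le_trans _ _ (S ([set: k1.-tuple _] `*`
      [set q | @reject_sample R n d M tau F q x]))).
    have := product_measure1E (iid (round_law n) k1) U measurableT mQ.
    rewrite [X in (X * _)%E]probability_setT mul1e => e.
    apply: (le_trans hQ); rewrite le_eqVlt; apply/orP; left; apply/eqP.
    exact: esym e.
  apply: le_measure; rewrite ?inE; first exact: measurableX.
    exact: measurable_ysection.
  by move=> [w q] [_ hq]; rewrite /ysection /= inE; exists i; split.
have := @prod_ge_of_ysection _ _ _ _ _ S (iid D k2) _ G _ mE mG c0 key.
apply: le_trans.
apply: (@le_trans _ _ ((39 / 40)%:E * (9 / 10)%:E)%E).
  by rewrite -EFinM lee_fin; lra.
apply: lee_wpmul2l => //; apply: le_trans PG; rewrite lee_fin.
have : (1 + k2%:R * (3 * eps / 4))^-1 <= 10^-1 by rewrite lef_pV2 ?posrE; lra.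
lra.
Qed.

End Rejection.

(** * Numbers of repetitions and the conclusion *)

Section Bounds.
Context {R : realType}.

(** Chosen so that [num_rounds d * round_err d = 2], which leaves a failure probability of at most
    [1 / (1 + 2)]. Likewise more than [12 / eps] samples, each useful with probability at least
    [3 * eps / 4], are all useless with probability at most [1 / (1 + 9)]. *)
Definition num_rounds (d : nat) : nat := 800 * d ^ 2.
Definition num_points (eps : R) : nat := (Num.truncn (12 / eps)).+1.

(** The logarithm vanishes as [eps] tends to 1, so [d ^ 2 / eps] is absorbed in two ways: for
    [eps <= 1 / 2] by the logarithm, which is at least [1 - eps], and otherwise by [d ^ 5]. *)
Lemma num_queries_bound (d : nat) (eps : R) : (0 < d)%N -> 0 < eps < 1 ->
  (num_rounds d * (3 * d.+2) + num_points eps * d.+2)%N%:R <=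
    8000 * (d%:R ^+ 5 + d%:R ^+ 2 / eps * ln (1 / eps)).
Proof.
move=> d0 /andP[e0 e1].
have d1 : 1 <= d%:R :> R by rewrite ler1n.
set x : R := d%:R in d1 *.
have d2 : d.+2%:R <= 3 * x by rewrite -natr1 -natr1 /x; lra.
have k2 : (num_points eps)%:R <= 13 / eps.
  have /andP[h _] : (Num.truncn (12 / eps))%:R <= 12 / eps < (Num.truncn (12 / eps)).+1%:R.
    by apply: truncn_itv; rewrite divr_ge0 // ltW.
  have h1 : 1 <= eps^-1 by rewrite invf_ge1 // ltW.
  by rewrite /num_points -natr1; lra.
have ieps : 0 < eps^-1 by rewrite invr_gt0.
have p2 : 1 <= x ^+ 2 by exact: exprn_ege1.
have p3 : x ^+ 3 <= x ^+ 5 by exact: ler_weXn2l.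
have p5 : x ^+ 2 <= x ^+ 5 by exact: ler_weXn2l.
have xx2 : x <= x ^+ 2 by rewrite -{1}[x]expr1; exact: ler_weXn2l.
have -> : (num_rounds d * (3 * d.+2) + num_points eps * d.+2)%N%:R =
    800 * x ^+ 2 * (3 * d.+2%:R) + (num_points eps)%:R * d.+2%:R.
  by rewrite natrD (natrM _ (num_points eps)) natrM (natrM _ 3) natrM natrX.
have t1 : 800 * x ^+ 2 * (3 * d.+2%:R) <= 7200 * x ^+ 5.
  apply: (@le_trans _ _ (800 * x ^+ 2 * (3 * (3 * x)))).
    by apply: ler_wpM2l; [rewrite mulr_ge0 ?ler0n // exprn_ge0|lra].
  have -> : 800 * x ^+ 2 * (3 * (3 * x)) = 7200 * x ^+ 3 by ring.
  lra.
have t2 : (num_points eps)%:R * d.+2%:R <= 39 * (x ^+ 2 / eps).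
  apply: (@le_trans _ _ (13 / eps * (3 * x))); first by apply: ler_pM.
  have -> : 13 / eps * (3 * x) = 39 * (x / eps) by ring.
  by apply: ler_wpM2l; [rewrite ler0n|rewrite ler_pM2r].
have ln0 : 1 - eps <= ln (1 / eps).
  rewrite div1r lnV ?posrE // lerNr opprB.
  by have := @le_ln1Dx R (eps - 1); rewrite (addrC eps) addNKr; apply; lra.
have q0 : 0 <= x ^+ 2 / eps by rewrite divr_ge0 ?exprn_ge0 // ltW.
have t3 : x ^+ 2 / eps <= 2 * (x ^+ 5 + x ^+ 2 / eps * ln (1 / eps)).
  have [eh|eh] := leP eps (1 / 2).
    have : x ^+ 2 / eps * (1 / 2) <= x ^+ 2 / eps * ln (1 / eps).
      by apply: ler_wpM2l => //; lra.
    have : 0 <= x ^+ 5 by exact: exprn_ge0.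
    lra.
  have : 0 <= x ^+ 2 / eps * ln (1 / eps) by rewrite mulr_ge0 //; lra.
  have : x ^+ 2 / eps <= x ^+ 2 * 2.
    by apply: ler_wpM2l; [exact: exprn_ge0|rewrite -[leRHS]invrK lef_pV2 ?posrE; lra].
  lra.
have q1 : 0 <= x ^+ 2 / eps * ln (1 / eps) by rewrite mulr_ge0 //; lra.
lra.
Qed.

Lemma total_err_bound (n d : nat) (r alpha beta : R) : (0 < n)%N -> (0 < d)%N ->
  0 < alpha ->
  2 ^+ ((2 * n) ^ (12 * d)) * Num.max 1 r ^+ d * alpha <= beta ->
  alpha * total_err n d <= beta.
Proof.
move=> n0 d0 a0; apply: le_trans; rewrite mulrC; apply: ler_wpM2r; first exact: ltW.
apply: le_trans (@total_err_le R n d n0 d0) _.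
apply: (@le_trans _ _ (2 ^+ ((2 * n) ^ (12 * d)))).
  by rewrite -!natrX ler_nat W_exp_le.
rewrite ler_peMr ?exprn_ge0 ?ler0n // exprn_ege1 // le_max lexx //.
Qed.

End Bounds.

Theorem theorem1p2 (R : realType) :
  exists C c : nat,
  forall (n d : nat) (eps r alpha beta : R),
    (0 < d)%N -> 0 < eps < 1 -> 0 < r -> 0 < alpha ->
    2 ^+ ((2 * n) ^ (c * d)) * Num.max 1 r ^+ d * alpha <= beta ->
  exists T : tester R n,
    (forall (f : Rn R n -> R) (w : seed T)
            (s : (num_samples T).-tuple (Rn R n)),
       (num_queries f (strategy w s))%:R
         <= C%:R * (d%:R ^+ 5 + d%:R ^+ 2 / eps * ln (1 / eps))) /\
    forall (f : Rn R n -> R) (D : probability (Rn R n) R),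
      [bounded f x | x in eball origin (2 * d%:R * Num.sqrt n%:R)] ->
      concentrated (eps / 4) r D ->
      ((exists h, poly_degree_le d h /\ pointwise_close alpha f h) ->
         has_prob_ge (run_law T D) (outcome_event T f true) 1) /\
      (measurable_fun setT f ->
       (forall h, poly_degree_le d h ->
          (eps%:E < D [set p | (beta < `|f p - h p|)%R])%E) ->
         has_prob_ge (run_law T D) (outcome_event T f false) (2 / 3)).
Proof.
exists 8000%N, 12%N => n d eps r alpha beta d0 eps01 r0 alpha0 hbeta.
have [eps0 eps1] := andP eps01.
case: (posnP n) hbeta => [->|n0] hbeta.
  (* In dimension 0 the space is a single point and every function is constant, so nothing is far
     and accepting is correct; [inv_step] would be 0 here. *)
  exists (@Tester R 0 _ _ unif01 0 (fun _ _ => Output _ _ true)); split.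
    move=> f w s /=; rewrite mulr_ge0 ?ler0n // addr_ge0 ?exprn_ge0 ?ler0n //.
    rewrite mulr_ge0 ?divr_ge0 ?exprn_ge0 ?ler0n ?(ltW eps0) //.
    by rewrite ln_ge0 // div1r invf_ge1 // ltW.
  move=> f D _ _; split.
    by move=> _; exists setT; split => //; rewrite probability_setT.
  have beta0 : 0 < beta.
    apply: lt_le_trans hbeta; apply: mulr_gt0 => //.
    by apply: mulr_gt0; apply: exprn_gt0; rewrite ?ltr0n // lt_max ltr01.
  move=> _ /(_ (fun=> f origin)) hfar.
  have : (eps%:E < D [set p | (beta < `|f p - f origin|)%R])%E.
    apply: hfar; exists (mpolyC 0 (f origin)); split.
      by rewrite msizeC; case: eqP.
    by move=> x; rewrite mevalC.
  have -> : [set p | beta < `|f p - f origin|] = set0.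
    rewrite -subset0 => p /=; rewrite (tuple0 p) (tuple0 origin) subrr normr0.
    by rewrite ltNge ltW.
  by rewrite measure0 lte_fin ltNge ltW.
(* Rescaling by [M] brings the ball of radius [r], where most samples fall, into the core where the
   polynomial approximation holds. The error factor [total_err] does not depend on [M]. *)
pose M : R := r / core_radius n d.
have s0 := @step_gt0 R n d n0 d0.
have core0 : 0 < core_radius n d :> R 
  by rewrite /core_radius /small_dir divr_gt0 ?ltr0n // mulr_gt0 // divr_gt0.
have M0 : 0 < M by rewrite divr_gt0.
pose A := @weight_bound R d (step n d).
have A1 : 1 <= A := weight_bound_ge1 s0 (@degree_step R n d n0 d0) d0.
pose tau : R := alpha * (1 + A).
have tau0 : 0 < tau by rewrite mulr_gt0 // (lt_le_trans ltr01) // lerDl (le_trans ler01).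
exists (@low_degree_tester R n d M tau (num_rounds d) (num_points eps)); split.
  move=> f w s; rewrite num_queries_low_degree_tester.
  exact: num_queries_bound.
move=> f D _ hD; split.
  move=> [h [hh hf]]; exists setT; split => //.
    move=> [w s] _; rewrite /outcome_event /= run_low_degree_tester.
    have tauE : tau = alpha * (1 + weight_bound d (step n d)) by [].
    exact: (completeness M n0 d0 tauE w s hh hf).
  by rewrite probability_setT.
move=> mf hfar.
have mF := measurable_rescale M mf.
(* Either one round rejects often enough for the repeated rounds to succeed, or all three tests hold
   with the error that [corrected_poly] tolerates and the samples must reveal the distance. *)
have [hrej|hrej] := leP (round_err d)%:E
    (round_law n [set w | @reject_round R n d tau (rescale M f) w]).
  apply: reject_by_rounds => //.
  have dn0 : d%:R != 0 :> R by rewrite pnatr_eq0 -lt0n.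
  rewrite /num_rounds natrM natrX /round_err.
  by rewrite (_ : _ * _ = 2) //; field.
have [t1 t2 t3] := round_reject_le mF (ltW hrej).
have [p sp hp] := corrected_poly n0 d0 mF tau0 t1 t2 t3.
apply: (@reject_by_samples R n d M tau _ _ M0 f D mf p eps r beta _ sp eps01 _ _ _ hp hD).
- by rewrite /M divfK // gt_eqF.
- apply: le_trans (total_err_bound n0 d0 alpha0 hbeta).
  by rewrite /total_err /tau -/A le_eqVlt; apply/orP; left; apply/eqP; ring.
- have /andP[_ h] : (Num.truncn (12 / eps))%:R <= 12 / eps < (num_points eps)%:R.
    by apply: truncn_itv; rewrite divr_ge0 // ltW.
  move: h; rewrite ltr_pdivrMr // => h; lra.
by apply: hfar; apply: (poly_degree_le_scale M^-1); exists p; split.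
Qed.
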